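(* Let $\beta>0$, and let $\rho_{\beta HE_N}$ and $\rho_{\beta FTE_N}$ be the eigenvalue densities of the $\beta$-Hermite ensemble and of the fixed trace $\beta$-Hermite ensemble of size $N$, respectively. Let $f\in C_c(\mathbb{R})$. If for every $h\in C_c(\mathbb{R})$ the limit $$\lim_{N\to\infty}\int_{\mathbb{R}}h(t)\,\frac{\sqrt{\beta}\,N^{5/6}}{\sqrt{2}}\,\rho_{\beta HE_N}\Big(\sqrt{2\beta N}\big(1+\tfrac{t}{2N^{2/3}}\big)\Big)\,dt$$ exists, then $$\lim_{N\to\infty}\int_{\mathbb{R}}f(x)\,\frac{N^{5/6}}{\sqrt{2}}\,\rho_{\beta FTE_N}\Big(\sqrt{2N}\big(1+\tfrac{x}{2N^{2/3}}\big)\Big)\,dx=\lim_{N\to\infty}\int_{\mathbb{R}}f(t)\,\frac{\sqrt{\beta}\,N^{5/6}}{\sqrt{2}}\,\rho_{\beta HE_N}\Big(\sqrt{2\beta N}\big(1+\tfrac{t}{2N^{2/3}}\big)\Big)\,dt.$$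
   Context: $C_c(\mathbb{R})$ is the set of continuous functions on $\mathbb{R}$ with compact support. For $\beta>0$ and $N\ge2$: The $\beta$-Hermite ensemble is the probability measure on $\mathbb{R}^N$ with density $$P_{\beta HE_N}(x_1,\dots,x_N)=\frac{1}{Z_{\beta HE_N}}\prod_{1\le j<k\le N}|x_j-x_k|^\beta\prod_{i=1}^N e^{-x_i^2/2},$$ and its eigenvalue density is $\rho_{\beta HE_N}(x_1)=\int_{\mathbb{R}^{N-1}}P_{\beta HE_N}(x_1,\dots,x_N)\,dx_2\cdots dx_N$. The fixed trace $\beta$-Hermite ensemble is the probability measure on $\mathbb{R}^N$ with (formal) density $$P_{\beta FTE_N}(x_1,\dots,x_N)=\frac{1}{Z_{\beta FTE_N}}\,\delta\Big(\sum_{i=1}^N x_i^2-\frac{N(N-1)}{2}\Big)\prod_{1\le j<k\le N}|x_j-x_k|^\beta,$$ i.e. the probability measure supported on the sphere $\sum_{i=1}^N x_i^2=N(N-1)/2$ whose density with respect to the surface measure of this sphere is proportional to $\prod_{j<k}|x_j-x_k|^\beta$. Its eigenvalue density $\rho_{\beta FTE_N}$ is the probability density on $\mathbb{R}$ of the one-dimensional marginal distribution of $x_1$ (it vanishes for $|x_1|>\sqrt{N(N-1)/2}$). *)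

(* Defs.v *)
From HB Require Import structures.
From mathcomp Require Import all_boot all_order all_algebra.
From mathcomp Require Import all_classical all_reals all_analysis.
From mathcomp Require Import measurable_realfun.

Set Implicit Arguments.
Unset Strict Implicit.
Unset Printing Implicit Defensive.
Import Order.TTheory GRing.Theory Num.Theory.
Import numFieldNormedType.Exports.
Local Open Scope classical_set_scope.
Local Open Scope ring_scope.

(* The sigma-algebra on tuples is the product of the Borel sigma-algebras. *)
Notation Rn R n := (n.-tuple (measurableTypeR R)).

Section lebesgue_tuple.
Context {R : realType}.

Definition tcons n (p : (measurableTypeR R * Rn R n)%type) : Rn R n.+1 :=
  cons_tuple p.1 p.2.

Lemma measurable_tcons n : measurable_fun setT (@tcons n).
Proof. exact: measurable_cons. Qed.

Fixpoint lebesgue_tuple n : set (Rn R n) -> \bar R :=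
  match n return set (Rn R n) -> \bar R with
  | 0 => dirac ([tuple] : Rn R 0)
  | m.+1 => pushforward (lebesgue_measure \x @lebesgue_tuple m)%E (@tcons m)
  end.

Section step.
Variables (n : nat) (mu : {sigma_finite_measure set (Rn R n) -> \bar R}).

Let m := (@lebesgue_measure R \x mu)%E.
Let nu : set (Rn R n.+1) -> \bar R := pushforward m (@tcons n).

HB.instance Definition _ := isMeasure.Build _ _ _ nu
  (@measure0 _ _ _ (measure_function_pushforward__canonical__measure_function_Measure
    m (@measurable_tcons n)))
  (@measure_ge0 _ _ _ (measure_function_pushforward__canonical__measure_function_Measure
    m (@measurable_tcons n)))
  (@measure_semi_sigma_additive _ _ _
    (measure_function_pushforward__canonical__measure_function_Measure
    m (@measurable_tcons n))).

Let m_sigma_finite : sigma_finite setT m.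
Proof.
have /sigma_finiteP[F [TF ndF Foo]] := sigma_finiteT (@lebesgue_measure R).
have /sigma_finiteP[G [TG ndG Goo]] := sigma_finiteT mu.
exists (fun k => F k `*` G k).
  rewrite -setXTT TF TG predeqE => -[x y]; split.
    move=> [/= [i _ Fix_] [j _ Gjy]]; exists (maxn i j) => //; split.
    - by move: x Fix_; exact/subsetPset/ndF/leq_maxl.
    - by move: y Gjy; exact/subsetPset/ndG/leq_maxr.
  by move=> [i _ []/= ? ?]; split; exists i.
move=> k; have [? ?] := Foo k; have [? ?] := Goo k.
split; first exact: measurableX.
by rewrite /m product_measure1E// lte_mul_pinfty// ge0_fin_numE.
Qed.

Let nu_sigma_finite : sigma_finite setT nu.
Proof.
have [F TF mF] := m_sigma_finite.
pose g (t : Rn R n.+1) := (thead t, [tuple of behead t] : Rn R n).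
have mg : measurable_fun setT g.
  apply/measurable_fun_pairP; split; last exact: measurable_behead.
  exact: measurable_tnth.
have fK : g \o @tcons n = id.
  by apply/funext => -[x t]; congr pair; exact/val_inj.
exists (fun i => g @^-1` F i).
  by rewrite -preimage_bigcup -TF preimage_setT.
move=> i; have [mFi Fioo] := mF i; split.
  by rewrite -[X in measurable X]setTI; exact: mg.
by rewrite /nu /pushforward -comp_preimage fK.
Qed.

HB.instance Definition _ := @Measure_isSigmaFinite.Build _ _ _ nu
  nu_sigma_finite.

Lemma tcons_measure :
  exists k : {sigma_finite_measure set (Rn R n.+1) -> \bar R},
    k = pushforward (@lebesgue_measure R \x mu)%E (@tcons n)
      :> (set _ -> \bar R).
Proof. by exists nu. Qed.

End step.

Lemma lebesgue_tuple_measure n :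
  exists mu : {sigma_finite_measure set (Rn R n) -> \bar R},
    mu = @lebesgue_tuple n :> (set _ -> \bar R).
Proof.
elim: n => [|n [mu muE]] /=; first by exists (dirac ([tuple] : Rn R 0)).
by rewrite -muE; exact: tcons_measure.
Qed.

Section instances.
Variable n : nat.

Let leb0 : @lebesgue_tuple n set0 = 0%E.
Proof. by have [mu <-] := lebesgue_tuple_measure n. Qed.

Let leb_ge0 A : (0 <= @lebesgue_tuple n A)%E.
Proof. by have [mu <-] := lebesgue_tuple_measure n. Qed.

Let leb_sigma_additive : semi_sigma_additive (@lebesgue_tuple n).
Proof.
have [mu <-] := lebesgue_tuple_measure n.
exact: measure_semi_sigma_additive.
Qed.

HB.instance Definition _ := isMeasure.Build _ _ _ (@lebesgue_tuple n)
  leb0 leb_ge0 leb_sigma_additive.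

Let leb_sigma_finite : sigma_finite setT (@lebesgue_tuple n).
Proof. by have [mu <-] := lebesgue_tuple_measure n; exact: sigma_finiteT. Qed.

HB.instance Definition _ := @Measure_isSigmaFinite.Build _ _ _
  (@lebesgue_tuple n) leb_sigma_finite.

End instances.
End lebesgue_tuple.

Section surface_measure.
Context {R : realType} (n : nat) (r : R).

Definition enorm (x : Rn R n) : R := Num.sqrt (\sum_(i < n) tnth x i ^+ 2).

Definition radial (x : Rn R n) : Rn R n :=
  [tuple r / enorm x * tnth x i | i < n].

(* Surface measure of the sphere of radius r, as a measure on R^n: a set A has
   measure (n / r) times the volume of the truncated cone over its intersection
   with the sphere.  The factor n / r makes it the (n-1)-dimensional area. *)
Definition surface_measure (A : set (Rn R n)) : \bar R :=
  ((n%:R / r)%:E * 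
    lebesgue_tuple (radial @^-1` A `&` [set x | (0 < enorm x <= r)%R]))%E.

Lemma measurable_enorm : measurable_fun setT enorm.
Proof.
apply: measurableT_comp => /=.
  by apply: continuous_measurable_fun => ?; exact: sqrt_continuous.
apply: measurable_sum => i; apply: measurable_funX; exact: measurable_tnth.
Qed.

Lemma measurable_radial : measurable_fun setT radial.
Proof.
apply/measurable_fun_tnthP => i.
rewrite (_ : _ \o _ = fun x => r / enorm x * tnth x i); last first.
  by apply/funext => x /=; rewrite tnth_mktuple.
apply: measurable_funM; last exact: measurable_tnth.
apply: measurable_funM => //.
rewrite (_ : (fun _ => _) = (fun x => enorm x `^ (-1))).
  exact: (measurableT_comp (@measurable_powR R (-1)) measurable_enorm).
by apply/funext => x; rewrite powR_inv1 // sqrtr_ge0.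
Qed.

Let cone := [set x | 0 < enorm x <= r].

Let measurable_cone : measurable cone.
Proof.
rewrite (_ : cone = enorm @^-1` `]0, r]); last first.
  by apply/seteqP; split => x; rewrite /cone /= in_itv.
by rewrite -[X in measurable X]setTI; exact: measurable_enorm.
Qed.

Let surface_measure_measure :
  exists mu : {measure set (Rn R n) -> \bar R},
    mu = surface_measure :> (set _ -> \bar R).
Proof.
have [r0|r0] := leP r 0.
  exists mzero; apply/funext => A; rewrite /surface_measure.
  rewrite (_ : [set x | _] = set0) ?setI0 ?measure0 ?mule0 //.
  by apply/seteqP; split => // x /= /andP[x0 /(lt_le_trans x0)]; rewrite ltNge r0.
have nr0 : 0 <= n%:R / r by rewrite divr_ge0 ?ler0n // ltW.
pose nu : {measure set (Rn R n) -> \bar R} :=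
  measure_function_pushforward__canonical__measure_function_Measure
    (mrestr (@lebesgue_tuple R n) measurable_cone) measurable_radial.
exists (mscale (NngNum nr0) nu).
by apply/funext => A; rewrite /mscale /= /pushforward /mrestr.
Qed.

Let surface_measure0 : surface_measure set0 = 0%E.
Proof. by have [mu <-] := surface_measure_measure. Qed.

Let surface_measure_ge0 A : (0 <= surface_measure A)%E.
Proof. by have [mu <-] := surface_measure_measure. Qed.

Let surface_measure_sigma_additive : semi_sigma_additive surface_measure.
Proof.
have [mu <-] := surface_measure_measure.
exact: measure_semi_sigma_additive.
Qed.

HB.instance Definition _ := isMeasure.Build _ _ _ surface_measure
  surface_measure0 surface_measure_ge0 surface_measure_sigma_additive.

End surface_measure.

Section ensembles.
Context {R : realType} (beta : R).

Definition vandermonde_weight N (x : Rn R N) : R :=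
  \prod_(j < N) \prod_(k < N | (j < k)%N) `|tnth x j - tnth x k| `^ beta.

Definition HE_weight N (x : Rn R N) : R :=
  vandermonde_weight x * \prod_(i < N) expR (- tnth x i ^+ 2 / 2).

Definition HE_partition N : R := \int[@lebesgue_tuple R N]_x HE_weight x.

Definition HE_density N (x : Rn R N) : R := (HE_partition N)^-1 * HE_weight x.

(* The value for N = 0 is junk. *)
Definition HE_eigenvalue_density (N : nat) : R -> R :=
  match N with
  | 0 => fun=> 0
  | n.+1 => fun x1 => \int[@lebesgue_tuple R n]_y HE_density (tcons (x1, y))
  end.

Definition FTE_radius (N : nat) : R := Num.sqrt (N%:R * (N%:R - 1) / 2).

Definition FTE_partition N : R :=
  \int[@surface_measure R N (FTE_radius N)]_x vandermonde_weight x.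

Definition FTE N (A : set (Rn R N)) : \bar R :=
  ((FTE_partition N)^-1%:E *
    \int[@surface_measure R N (FTE_radius N)]_(x in A)
      (vandermonde_weight x)%:E)%E.

(* rho is a version of the density of the law of the first coordinate; it is
   determined only almost everywhere. *)
Definition is_FTE_eigenvalue_density (N : nat) (rho : R -> R) : Prop :=
  [/\ measurable_fun [set: R] rho,
      forall x, 0 <= rho x &
      forall B : set (measurableTypeR R), measurable B ->
        FTE [set x : Rn R N | B (head 0 (x : seq R))] =
        (\int[@lebesgue_measure R]_(x in B) (rho x)%:E)%E].

End ensembles.

Definition Cc {R : realType} (f : R -> R) : Prop :=
  continuous f /\ compact (closure [set x | f x != 0]).

(* Main.v *)
Require Import Defs.
From HB Require Import structures.
From mathcomp Require Import all_boot all_order all_algebra.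
From mathcomp Require Import all_classical all_reals all_analysis.
From mathcomp Require Import measurable_realfun.
From mathcomp Require Import ring lra.

(** Write a point of R^N as x = |x| theta with theta on the unit sphere.  The
    Vandermonde weight is homogeneous, of degree d = beta N(N-1)/2, so under the
    beta-Hermite law the direction theta has a density proportional to the
    Vandermonde weight and is independent of |x|.  The fixed trace law is that
    of r theta, where r ^ 2 = N(N-1)/2 (lemma [FTE_HE_ratio]).  Both rescaled
    integrals therefore become N times an expectation over one and the same
    beta-Hermite vector x: the Hermite one of f (u), where u is the edge variable
    of the first coordinate of x ([Rintegral_HE_edge]), the fixed trace one of
    f (v), where v is the edge variable of the first coordinate of r x / |x|
    ([Rintegral_FTE_edge]).

    With q = N ^ (2/3) and U = |x| / sqrt d the two edge variables satisfy
    2q + u = U (2q + v) ([edge_relation]).  The variable |x| ^ 2 has a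
    chi-squared law with N + d degrees of freedom, so U - 1 is of order 1/N,
    far below 1/q.  Take delta = N ^ (-5/6), which lies strictly between these
    two scales.

    On the event that U ^ 2 is within delta of 1, u and v differ by an amount
    tending to 0 as soon as one of them lies in the support of f; hence
    f (u) - f (v) is at most eps h (u), where h is a continuous cutoff equal to 1
    near the support of f.  The factor N is then harmless, because N E h (u)
    converges by hypothesis, hence is bounded.

    On the complementary event the factor N has to be beaten by the probability.
    Since the integral of the Vandermonde weight against exp (- c |x| ^ 2 / 2) is
    exactly c ^ (- (N + d) / 2) times its value at c = 1, an exponential Chebyshev
    bound ([HE_chernoff]) gives a probability at most
    2 exp (- d delta ^ 2 / 16 + N delta), in which d delta ^ 2 is of order
    N ^ (1/3) and N delta = N ^ (1/6); times N this tends to 0 ([tail_bound]).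
    Both events are handled at once by a pointwise inequality
    ([edge_pointwise]), which is integrated in [edge_integral_close]. *)

Set Implicit Arguments.
Unset Strict Implicit.
Unset Printing Implicit Defensive.
Import Order.TTheory GRing.Theory Num.Theory.
Import numFieldNormedType.Exports.
Local Open Scope classical_set_scope.
Local Open Scope ring_scope.

(** * Measures with a density *)

Section density.
Local Open Scope ereal_scope.
Context d (T : measurableType d) (R : realType) (mu : {measure set T -> \bar R}).
Context (w : T -> R) (mw : measurable_fun setT w) (w0 : forall x, (0 <= w x)%R).

Definition withdensity (A : set T) : \bar R := \int[mu]_(x in A) (w x)%:E.

Let mEw : measurable_fun setT (EFin \o w).
Proof. exact/measurable_EFinP. Qed.

Let Ew0 x : 0 <= (w x)%:E. Proof. by rewrite lee_fin. Qed.

Let withdensity0 : withdensity set0 = 0.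
Proof. exact: integral_set0. Qed.

Let withdensity_ge0 A : 0 <= withdensity A.
Proof. exact: integral_ge0. Qed.

Let withdensity_sigma_additive : semi_sigma_additive withdensity.
Proof.
move=> A mA tA mUA; rewrite /withdensity ge0_integral_bigcup//.
  by apply: is_cvg_ereal_nneg_natsum_cond => n _ _; exact: integral_ge0.
exact: measurable_funTS.
Qed.

HB.instance Definition _ := isMeasure.Build _ _ _ withdensity
  withdensity0 withdensity_ge0 withdensity_sigma_additive.

Import HBNNSimple.

(** The identity holds for simple functions by definition of the measure, and
    monotone convergence carries it to all nonnegative functions. *)
Lemma ge0_integral_withdensity (f : T -> \bar R) :
  measurable_fun setT f -> (forall x, 0 <= f x) ->
  \int[withdensity]_x f x = \int[mu]_x (f x * (w x)%:E).
Proof.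
move=> mf f0.
pose f_ := nnsfun_approx measurableT mf.
have mfr n (r : R) : measurable (f_ n @^-1` [set r]) by exact: measurable_funPTI.
transitivity (limn (fun n => \int[withdensity]_x (f_ n x)%:E)).
  rewrite -monotone_convergence//.
  - apply: eq_integral => y _; apply/esym/cvg_lim => //.
    exact: cvg_nnsfun_approx.
  - by move=> n; exact/measurable_EFinP/measurable_funP.
  - by move=> n y _; rewrite lee_fin.
  - by move=> y _ m n mn; rewrite lee_fin; exact/lefP/nd_nnsfun_approx.
rewrite [X in limn X](_ : _ = (fun n => \int[mu]_x ((f_ n x)%:E * (w x)%:E))).
  rewrite -monotone_convergence//; last 3 first.
  - by move=> n; apply: emeasurable_funM => //; exact/measurable_EFinP/measurable_funP.
  - by move=> n x _ /=; rewrite mule_ge0 ?lee_fin.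
  - by move=> x _ m n mn; rewrite lee_wpmul2r// lee_fin; exact/lefP/nd_nnsfun_approx.
  apply: eq_integral => x _; apply/cvg_lim => //.
  by apply: cvgeZr => //; exact: cvg_nnsfun_approx.
apply/funext => n.
rewrite integralT_nnsfun sintegralE.
transitivity (\sum_(k \in range (f_ n))
    \int[mu]_x ((k * \1_(f_ n @^-1` [set k]) x)%:E * (w x)%:E)).
  apply: eq_fsbigr => r; rewrite inE => -[x _ <-].
  under eq_integral do rewrite EFinM -muleA muleC.
  rewrite ge0_integralZr//; last 3 first.
  - by apply: emeasurable_funM => //; exact/measurable_EFinP/measurable_indic.
  - by move=> y _; rewrite mule_ge0// lee_fin.
  - by rewrite lee_fin.
  rewrite muleC; congr (_ * _).
  rewrite /= /withdensity integral_mkcond; apply: eq_integral => y _.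
  by rewrite patchE indicE; case: (y \in _); rewrite ?mul1e ?mul0e.
rewrite -ge0_integral_fsum//.
- apply: eq_integral => x _; rewrite -ge0_mule_fsuml.
    by rewrite fsumEFin// -fimfunE.
  by move=> i; rewrite EFinM nnfun_muleindic_ge0.
- move=> r; apply: emeasurable_funM => //; apply/measurable_EFinP/measurable_funM => //.
- by move=> r x _; rewrite mule_ge0// EFinM nnfun_muleindic_ge0.
Qed.

(** The measure is produced existentially: its measure structure depends on the
    proofs that the weight is measurable and nonnegative, which cannot be
    recovered from the bare set function. *)
Lemma exists_density_measure : exists nu : {measure set T -> \bar R},
  (forall A, nu A = \int[mu]_(x in A) (w x)%:E) /\
  forall f : T -> \bar R, measurable_fun setT f -> (forall x, 0 <= f x) ->
    \int[nu]_x f x = \int[mu]_x (f x * (w x)%:E).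
Proof. by exists withdensity; split => // f mf f0; exact: ge0_integral_withdensity. Qed.

End density.

Section transfer.
Context d1 d2 (T1 : measurableType d1) (T2 : measurableType d2) (R : realType).
Context (mu1 : {measure set T1 -> \bar R}) (mu2 : {measure set T2 -> \bar R}).
Context (phi : T2 -> T1) (w1 : T1 -> R) (w2 : T2 -> R).
Context (w1_ge0 : forall x, 0 <= w1 x) (w2_ge0 : forall x, 0 <= w2 x).

(** A statement about the law of [phi], known on measurable sets only, is turned
    into one about integrals of functions.  This is how the definition of the
    fixed trace eigenvalue density is put to use. *)
Lemma density_transfer : measurable_fun setT phi ->
  measurable_fun setT w1 -> measurable_fun setT w2 ->
  (forall B, measurable B ->
    \int[mu2]_(x in phi @^-1` B) (w2 x)%:E = \int[mu1]_(y in B) (w1 y)%:E)%E ->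
  forall f : T1 -> \bar R, measurable_fun setT f -> (forall y, 0 <= f y)%E ->
  (\int[mu1]_y (f y * (w1 y)%:E) = \int[mu2]_x (f (phi x) * (w2 x)%:E))%E.
Proof.
move=> mphi mw1 mw2 w12 f mf f0.
have [nu1 [nu1E <-//]] := exists_density_measure mu1 mw1 w1_ge0.
have [nu2 [nu2E <-//]] := exists_density_measure mu2 mw2 w2_ge0; last first.
  exact: measurableT_comp.
rewrite -[RHS](@ge0_integral_pushforward _ _ _ _ _ _ mphi _ setT)//.
apply: (eq_measure_integral
  (measure_function_pushforward__canonical__measure_function_Measure nu2 mphi)).
by move=> B mB _; rewrite nu1E -w12//= -nu2E.
Qed.

(** Only bounded nonnegative functions have to be tested: the positive part of
    [g * w] is [g^\+ * w] when [w >= 0], so the general case follows without any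
    integrability assumption. *)
Lemma Rintegral_transfer (C : R) :
  (forall g : T1 -> R, measurable_fun setT g -> (forall y, 0 <= g y <= C) ->
    (\int[mu1]_y (g y * w1 y)%:E = \int[mu2]_x (g (phi x) * w2 x)%:E)%E) ->
  forall g : T1 -> R, measurable_fun setT g -> (forall y, `|g y| <= C) ->
  \int[mu1]_y (g y * w1 y) = \int[mu2]_x (g (phi x) * w2 x).
Proof.
move=> H g mg gC; rewrite /Rintegral; congr fine.
have posE d (T : measurableType d) (h w : T -> R) : (forall x, 0 <= w x) ->
    ((fun x => (h x * w x)%:E)^\+)%E = fun x => (h^\+ x * w x)%:E.
  move=> w0; apply/funext => x; rewrite funeposE /funrpos -EFin_max; congr EFin.
  by rewrite maxr_pMl// mul0r.
have negE d (T : measurableType d) (h w : T -> R) : (forall x, 0 <= w x) ->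
    ((fun x => (h x * w x)%:E)^\-)%E = fun x => (h^\- x * w x)%:E.
  move=> w0; apply/funext => x.
  rewrite funenegE /funrneg -EFinN -EFin_max; congr EFin.
  by rewrite maxr_pMl// mul0r mulNr.
rewrite integralE [RHS]integralE !posE// !negE//; congr (_ - _)%E.
- rewrite H// => [|y]; first exact: measurable_funrpos.
  rewrite funrpos_ge0 /= ge_max (le_trans (ler_norm _) (gC y)).
  exact: le_trans (gC y).
- rewrite H// => [|y]; first exact: measurable_funrneg.
  rewrite funrneg_ge0 /= ge_max (le_trans _ (gC y)) ?(le_trans _ (gC y))//.
  by rewrite lerNl lerNnormlW.
Qed.

End transfer.

(** * Scaling and products for Lebesgue measure on tuples *)

(** Both sides are integrals against measures that agree on half-open intervals,
    hence everywhere. *)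
Lemma ge0_integral_affine (R : realType) (a b : R) (f : R -> \bar R) :
  0 < a -> measurable_fun setT f -> (forall x, 0 <= f x)%E ->
  (\int[@lebesgue_measure R]_t f (a * t + b)%R =
   a^-1%:E * \int[@lebesgue_measure R]_x f x)%E.
Proof.
move=> a0 mf f0.
have ma : measurable_fun [set: measurableTypeR R]
    (fun t : measurableTypeR R => (a * t + b)%R : measurableTypeR R).
  by apply: measurable_funD => //; exact: measurable_funM.
have ai0 : 0 <= a^-1 by rewrite invr_ge0 ltW.
pose nu : {measure set (measurableTypeR R) -> \bar R} :=
  measure_function_pushforward__canonical__measure_function_Measure
    (@lebesgue_measure R) ma.
have nuE A : measurable A ->
    nu A = mscale (NngNum ai0) (@lebesgue_measure R) A.
  move=> mA; suff /lebesgue_measure_unique /(_ _ mA) lebE :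
      forall X, ocitv X -> @lebesgue_measure R X =
      mscale (NngNum (ltW a0)) nu X.
    rewrite /mscale /= lebE /mscale /= muleA -EFinM mulVf ?mul1e//.
    exact: lt0r_neq0.
  move=> _ [[u v]] _ <-; rewrite /mscale/= /pushforward.
  rewrite (_ : _ @^-1` _ = `](u - b) / a, (v - b) / a]%classic); last first.
    apply/seteqP; split=> t /=; rewrite !in_itv/= ltr_pdivrMr// ler_pdivlMr//;
      by rewrite ltrBlDr lerBrDr mulrC.
  rewrite !lebesgue_measure_itv/= !lte_fin ltr_pM2r ?invr_gt0// ltrD2r.
  case: ifPn => _; last by rewrite mule0.
  rewrite -!EFinD -EFinM; congr EFin; field; exact: lt0r_neq0.
rewrite -[LHS](@ge0_integral_pushforward _ _ _ _ _ _ ma _ setT f)//.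
rewrite -[RHS]/((NngNum ai0)%:num%:E * _)%E -ge0_integral_mscale//.
by apply: (@eq_measure_integral _ _ _ _ _ nu) => A mA _; exact: nuE.
Qed.

Section tuple_integrals.
Context {R : realType}.
Implicit Types n : nat.

Lemma ge0_integral_lebesgue_tupleS n (f : Rn R n.+1 -> \bar R) :
  measurable_fun setT f -> (forall x, 0 <= f x)%E ->
  (\int[@lebesgue_tuple R n.+1]_x f x =
   \int[@lebesgue_measure R]_x \int[@lebesgue_tuple R n]_y f (tcons (x, y)))%E.
Proof.
move=> mf f0.
have mfc : measurable_fun setT (f \o @tcons R n).
  by apply: measurableT_comp => //; exact: measurable_tcons.
rewrite -(@fubini_tonelli1 _ _ _ _ _ (@lebesgue_measure R) (@lebesgue_tuple R n) _ mfc)//.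
rewrite -[RHS](@ge0_integral_pushforward _ _ _ _ _ _ (@measurable_tcons R n) _ setT f)//.
by move=> x; exact: f0.
Qed.

Definition tscale n (c : R) (x : Rn R n) : Rn R n := [tuple c * tnth x i | i < n].

Lemma measurable_tscale n c : measurable_fun setT (@tscale n c).
Proof.
apply/measurable_fun_tnthP => i.
rewrite (_ : _ \o _ = fun x => c * tnth x i); last first.
  by apply/funext => x /=; rewrite tnth_mktuple.
by apply: measurable_funM => //; exact: measurable_tnth.
Qed.

Lemma tscale_tcons n c x (y : Rn R n) :
  tscale c (tcons (x, y)) = tcons (c * x, tscale c y).
Proof.
apply: eq_from_tnth => i; rewrite tnth_mktuple.
by case: (unliftP ord0 i) => [j|] ->; rewrite ?tnth0 ?tnthS ?tnth_mktuple.
Qed.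

Lemma ge0_integral_tscale n (c : R) (f : Rn R n -> \bar R) :
  0 < c -> measurable_fun setT f -> (forall x, 0 <= f x)%E ->
  (\int[@lebesgue_tuple R n]_x f (tscale c x) =
   (c ^- n)%:E * \int[@lebesgue_tuple R n]_x f x)%E.
Proof.
move=> c0; elim: n f => [|n IH] f mf f0.
  rewrite /= !integral_dirac// ?diracT ?mul1e; last first.
    by apply: measurableT_comp => //; exact: measurable_tscale.
  by rewrite expr0 invr1 mul1e; congr f; apply: eq_from_tnth => -[].
have mfc : measurable_fun setT (f \o @tcons R n).
  by apply: measurableT_comp => //; exact: measurable_tcons.
have mfx x : measurable_fun setT (fun y : Rn R n => f (tcons (x, y))).
  exact: (measurableT_comp mfc).
rewrite !ge0_integral_lebesgue_tupleS//; last first.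
  by apply: measurableT_comp => //; exact: measurable_tscale.
under eq_integral.
  move=> x _; under eq_integral do rewrite tscale_tcons.
  rewrite (IH (fun y => f (tcons (c * x, y))))//.
  over.
pose F x := (\int[@lebesgue_tuple R n]_y f (tcons (x, y)))%E.
have mF : measurable_fun setT F.
  exact: (@measurable_fun_fubini_tonelli_F _ _ _ _ _ (@lebesgue_tuple R n) _ mfc (fun=> f0 _)).
have F0 x : (0 <= F x)%E by exact: integral_ge0.
have mFc : measurable_fun setT (fun x => F (c * x)).
  by apply: (measurableT_comp mF) => //; exact: measurable_funM.
transitivity ((c ^- n)%:E * \int[@lebesgue_measure R]_x F (c * x)%R)%E.
  apply: ge0_integralZl => //; first by move=> x _; exact: F0.
  by rewrite lee_fin invr_ge0 exprn_ge0// ltW.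
have -> : (\int[@lebesgue_measure R]_x F (c * x)%R =
    c^-1%:E * \int[@lebesgue_measure R]_x F x)%E.
  have := ge0_integral_affine 0 c0 mF F0.
  by under eq_integral do rewrite addr0.
by rewrite muleA -EFinM exprSr invfM.
Qed.

Lemma integral_prod_tuple n (g : R -> R) : measurable_fun setT g ->
  (forall x, 0 <= g x) ->
  (\int[@lebesgue_tuple R n]_x (\prod_(i < n) g (tnth x i))%:E =
   (\int[@lebesgue_measure R]_x (g x)%:E) ^+ n)%E.
Proof.
move=> mg g0.
have mpr k : measurable_fun setT (fun x : Rn R k => \prod_(i < k) g (tnth x i)).
  by apply: measurable_prod => i _; apply: measurableT_comp => //; exact: measurable_tnth.
have pr0 k (x : Rn R k) : 0 <= \prod_(i < k) g (tnth x i) by exact: prodr_ge0.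
elim: n => [|n IH].
  rewrite /= integral_dirac//; last by apply/measurable_EFinP; exact: mpr.
  by rewrite big_ord0 diracT mul1e.
have mprE : measurable_fun setT
    (fun x : Rn R n.+1 => (\prod_(i < n.+1) g (tnth x i))%:E).
  by apply/measurable_EFinP; exact: mpr.
rewrite (ge0_integral_lebesgue_tupleS mprE); last by move=> x; rewrite lee_fin.
transitivity (\int[@lebesgue_measure R]_x ((g x)%:E *
    \int[@lebesgue_tuple R n]_y (\prod_(i < n) g (tnth y i))%:E))%E.
  apply: eq_integral => x _; rewrite -ge0_integralZl ?lee_fin//; last 2 first.
  - by apply/measurable_EFinP; exact: mpr.
  - by move=> y _; rewrite lee_fin.
  apply: eq_integral => y _; rewrite big_ord_recl tnth0 EFinM.
  by under eq_bigr do rewrite tnthS.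
rewrite ge0_integralZr//.
- by rewrite IH expeS.
- exact/measurable_EFinP.
- by move=> x _; rewrite lee_fin.
- by apply: integral_ge0 => x _; rewrite lee_fin.
Qed.

End tuple_integrals.

(** * Polar decomposition of homogeneous integrands *)

Section closed_rays.
Context {R : realType}.

Lemma measurable_closed_rays : @measurable _ (measurableTypeR R) =
  <<s [set A : set R | exists x, A = `]-oo, x]%classic] >>.
Proof.
rewrite eqEsubset; split => A.
  apply: smallest_sub; first exact: smallest_sigma_algebra.
  move=> _ [[a b] _ <-] /=.
  (* the half-open intervals generate the Borel sets by definition *)
  rewrite (_ : `]a, b]%classic = `]-oo, b] `\` `]-oo, a]); last first.
    apply/seteqP; split=> x /=; rewrite !in_itv/=.
      by move=> /andP[ax xb]; split=> //; apply/negP; rewrite -ltNge.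
    by move=> [xb /negP]; rewrite -ltNge xb => ->.
  apply: (@measurableD _ (g_sigma_algebraType _)); apply: sub_sigma_algebra;
    by eexists.
by apply: smallest_sub; [exact: smallest_sigma_algebra|move=> _ [x ->]].
Qed.

(** Radial laws are easiest to evaluate on closed rays, because the preimage of
    a closed ray under the norm is a cone to which scaling applies. *)
Lemma measure_unique_rays (m1 m2 : {measure set (measurableTypeR R) -> \bar R}) :
  (forall x : R, m1 `]-oo, x]%classic = m2 `]-oo, x]%classic) ->
  (forall x : R, (m1 `]-oo, x]%classic < +oo)%E) ->
  forall A, measurable A -> m1 A = m2 A.
Proof.
move=> m12 m1oo A mA.
apply: (@measure_unique _ R (measurableTypeR R)
  [set A : set R | exists x, A = `]-oo, x]%classic]
  (fun k => `]-oo, k%:R]%classic)) mA.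
- exact: measurable_closed_rays.
- move=> _ _ [x ->] [y ->]; exists (Order.min x y).
  apply/seteqP; split=> z /=; rewrite !in_itv/= le_min.
    by case=> -> ->.
  by move/andP.
- by move=> k; exists k%:R.
- apply/seteqP; split => // x _; exists (Num.truncn `|x|).+1 => //=.
  rewrite in_itv/= (le_trans (ler_norm x))//.
  exact/ltW/truncnS_gt.
- by move=> _ [x ->].
- by move=> k; exact: m1oo.
Qed.

End closed_rays.

Section polar.
Context {R : realType} (n : nat).
Implicit Types G H : Rn R n -> R.

Lemma enorm_tscale c (x : Rn R n) : 0 <= c -> enorm (tscale c x) = c * enorm x.
Proof.
move=> c0; rewrite /enorm.
under eq_bigr do rewrite tnth_mktuple exprMn.
by rewrite -mulr_sumr sqrtrM ?sqr_ge0// sqrtr_sqr ger0_norm.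
Qed.

(** The origin is removed from the cones because projecting to the sphere makes
    no sense there. *)
Definition cone (r : R) := [set x : Rn R n | 0 < enorm x <= r].

Definition punctured := [set x : Rn R n | 0 < enorm x].

Lemma measurable_enorm_preimage (A : set R) : measurable (A : set (measurableTypeR R)) ->
  measurable (@enorm R n @^-1` A).
Proof. by move=> mA; rewrite -[X in measurable X]setTI; exact: measurable_enorm. Qed.

Lemma measurable_cone r : measurable (cone r).
Proof.
rewrite (_ : cone r = enorm (n:=n) @^-1` `]0, r]).
  exact: measurable_enorm_preimage.
by apply/seteqP; split => x; rewrite /cone /= in_itv.
Qed.

Lemma measurable_punctured : measurable punctured.
Proof.
rewrite (_ : punctured = enorm (n:=n) @^-1` `]0, +oo[).
  exact: measurable_enorm_preimage.
by apply/seteqP; split => x; rewrite /punctured /= in_itv/= andbT.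
Qed.

Definition homogeneous0 G := forall c x, 0 < c -> G (tscale c x) = G x.

Local Notation vol := (@lebesgue_tuple R n).

Definition cone_integral G r := (\int[vol]_(x in cone r) (G x)%:E)%E.

(** Scaling by [s / r] maps the cone of radius [r] onto that of radius [s], leaves
    [G] invariant and multiplies the volume by [(s / r) ^+ n]. *)
Lemma cone_integral_scale G r s : measurable_fun setT G -> (forall x, 0 <= G x) ->
  homogeneous0 G -> 0 < r -> 0 < s ->
  cone_integral G s = (((s / r) ^+ n)%:E * cone_integral G r)%E.
Proof.
move=> mG G0 hG r0 s0.
have c0 : 0 < r / s by rewrite divr_gt0.
have mGr : measurable_fun setT ((EFin \o G) \_ (cone r)).
  apply/measurable_restrict => //; first exact: measurable_cone.
  by apply: measurable_funTS; exact/measurable_EFinP.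
have Gr0 x : (0 <= ((EFin \o G) \_ (cone r)) x)%E.
  by rewrite patchE; case: ifP => //; rewrite lee_fin.
have coneE t : cone_integral G t = (\int[vol]_x ((EFin \o G) \_ (cone t)) x)%E.
  by rewrite /cone_integral integral_mkcond.
have := ge0_integral_tscale c0 mGr Gr0.
rewrite -exprVn invf_div -coneE => <-; rewrite coneE; apply: eq_integral => x _.
rewrite !patchE /= hG//; congr (if _ then _ else _).
rewrite /cone; apply/idP/idP; rewrite !inE /= enorm_tscale ?(ltW c0)//.
  move=> /andP[x0 xs]; rewrite mulr_gt0//= mulrAC ler_pdivrMr// ler_pM2l//.
by rewrite pmulr_rgt0// mulrAC ler_pdivrMr// ler_pM2l.
Qed.

Lemma cone_integral_le0 G r : r <= 0 -> cone_integral G r = 0%E.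
Proof.
move=> r0; rewrite /cone_integral (_ : cone r = set0) ?integral_set0//.
apply/seteqP; split => // x /= /andP[x0 /(lt_le_trans x0)].
by rewrite ltNge r0.
Qed.

(** The radial law of [G]: the image of the measure of density [G] under the norm.
    For a function that is homogeneous of degree 0 this law is determined, up to
    the constant [cone_integral G r], by [cone_integral_scale]; this replaces the
    usual formula for integration in polar coordinates. *)
Lemma exists_radial_measure G : measurable_fun setT G -> (forall x, 0 <= G x) ->
  exists nu : {measure set (measurableTypeR R) -> \bar R},
    (forall r, nu `]-oo, r]%classic = cone_integral G r) /\
    forall phi : R -> R, measurable_fun setT phi -> (forall s, 0 <= phi s) ->
      (\int[nu]_s (phi s)%:E =
       \int[vol]_(x in punctured) (phi (enorm x) * G x)%:E)%E.
Proof.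
move=> mG G0.
have mG0 : measurable_fun setT (G \_ punctured).
  apply/measurable_restrict => //; first exact: measurable_punctured.
  exact: measurable_funTS.
have G00 x : 0 <= (G \_ punctured) x by rewrite patchE; case: ifP.
have [nu [nuE nuI]] := exists_density_measure vol mG0 G00.
have me : measurable_fun setT (@enorm R n : Rn R n -> measurableTypeR R).
  exact: measurable_enorm.
exists (measure_function_pushforward__canonical__measure_function_Measure nu me); split => [r|phi mphi phi0].
  rewrite /= /pushforward nuE [LHS]integral_mkcond.
  rewrite /cone_integral [RHS]integral_mkcond.
  apply: eq_integral => x _; rewrite !patchE.
  have -> : (x \in cone r) = (x \in enorm (n:=n) @^-1` `]-oo, r]) && (x \in punctured).
    rewrite /cone /punctured; apply/idP/andP; rewrite !inE/= in_itv/=.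
      by move=> /andP[].
    by move=> [-> ->].
  by case: ifP => //= _; case: ifP.
rewrite ge0_integral_pushforward//; last 2 first.
- exact/measurable_EFinP.
- by move=> s _; rewrite lee_fin.
rewrite nuI//; last 2 first.
- apply/measurable_EFinP; apply: measurableT_comp => //; exact: measurable_enorm.
- by move=> x; rewrite lee_fin.
rewrite [RHS]integral_mkcond; apply: eq_integral => x _.
by rewrite !patchE /=; case: ifP; rewrite -EFinM// mulr0.
Qed.

(** The radial laws of [G] and [H] agree on rays up to the constants
    [cone_integral G r] and [cone_integral H r], hence they are proportional and
    integrate every [phi] in the same proportion.  This is the independence of
    radius and direction. *)
Lemma polar_proportional G H r (phi : R -> R) : 0 < r ->
  measurable_fun setT G -> (forall x, 0 <= G x) -> homogeneous0 G ->
  measurable_fun setT H -> (forall x, 0 <= H x) -> homogeneous0 H ->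
  (cone_integral G r < +oo)%E -> (cone_integral H r < +oo)%E ->
  measurable_fun setT phi -> (forall s, 0 <= phi s) ->
  (cone_integral H r * \int[vol]_(x in punctured) (phi (enorm x) * G x)%:E =
   cone_integral G r * \int[vol]_(x in punctured) (phi (enorm x) * H x)%:E)%E.
Proof.
move=> r0 mG G0 hG mH H0 hH Goo Hoo mphi phi0.
have [nuG [nuGE <-//]] := exists_radial_measure mG G0.
have [nuH [nuHE <-//]] := exists_radial_measure mH H0.
have cG0 : (0 <= cone_integral G r)%E by apply: integral_ge0 => x _; rewrite lee_fin.
have cH0 : (0 <= cone_integral H r)%E by apply: integral_ge0 => x _; rewrite lee_fin.
have fG : cone_integral G r \is a fin_num by rewrite ge0_fin_numE.
have fH : cone_integral H r \is a fin_num by rewrite ge0_fin_numE.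
have kG0 := fine_ge0 cG0; have kH0 := fine_ge0 cH0.
have mphiE : measurable_fun setT (EFin \o phi) by exact/measurable_EFinP.
rewrite -(fineK fG) -(fineK fH).
rewrite -[fine (cone_integral H r)]/((NngNum kH0)%:num).
rewrite -[fine (cone_integral G r)]/((NngNum kG0)%:num).
rewrite -!ge0_integral_mscale//; last 2 first.
- by move=> s _; rewrite lee_fin.
- by move=> s _; rewrite lee_fin.
apply: eq_measure_integral => A mA _; apply: measure_unique_rays => // s.
- transitivity ((fine (cone_integral H r))%:E * cone_integral G s)%E.
    by rewrite -nuGE.
  transitivity ((fine (cone_integral G r))%:E * cone_integral H s)%E; last first.
    by rewrite -nuHE.
  rewrite !fineK//.
  have [s0|s0] := leP s 0; first by rewrite !(cone_integral_le0 _ s0) !mule0.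
  rewrite (cone_integral_scale mG G0 hG r0 s0) (cone_integral_scale mH H0 hH r0 s0).
  by rewrite !muleA [(cone_integral H r * _)%E]muleC [(cone_integral G r * _)%E]muleC -!muleA [(cone_integral G r * _)%E]muleC.
- rewrite [ltLHS](_ : _ = (fine (cone_integral H r))%:E * cone_integral G s)%E.
    2: by rewrite -nuGE.
  rewrite fineK//.
  have [s0|s0] := leP s 0; first by rewrite (cone_integral_le0 _ s0) mule0.
  rewrite (cone_integral_scale mG G0 hG r0 s0).
  by rewrite -(fineK fG) -(fineK fH) -!EFinM ltry.
Qed.

(** With [polar_eq0_inv], this says that the two normalizations in [polar_ratio]
    vanish together, so that no positivity of the weights has to be proved. *)
Lemma polar_eq0 H r (phi : R -> R) : 0 < r ->
  measurable_fun setT H -> (forall x, 0 <= H x) -> homogeneous0 H ->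
  measurable_fun setT phi -> (forall s, 0 <= phi s) ->
  cone_integral H r = 0%E ->
  (\int[vol]_(x in punctured) (phi (enorm x) * H x)%:E = 0)%E.
Proof.
move=> r0 mH H0 hH mphi phi0 cH.
have [nuH [nuHE <-//]] := exists_radial_measure mH H0.
rewrite (eq_measure_integral mzero) ?integral_measure_zero// => A mA _.
apply: measure_unique_rays => // s; rewrite nuHE.
- have [s0|s0] := leP s 0; first by rewrite !cone_integral_le0.
  by rewrite (cone_integral_scale mH H0 hH r0 s0) cH mule0.
- have [s0|s0] := leP s 0; first by rewrite !cone_integral_le0.
  by rewrite (cone_integral_scale mH H0 hH r0 s0) cH mule0.
Qed.

Lemma polar_eq0_inv H r (phi : R -> R) :
  measurable_fun setT H -> (forall x, 0 <= H x) ->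
  measurable_fun setT phi -> (forall s, 0 < s -> 0 < phi s) ->
  (\int[vol]_(x in punctured) (phi (enorm x) * H x)%:E = 0)%E ->
  cone_integral H r = 0%E.
Proof.
move=> mH H0 mphi phi0 I0.
have mphiH : measurable_fun punctured (fun x => (phi (enorm x) * H x)%:E).
  apply: measurable_funTS; apply/measurable_EFinP/measurable_funM => //.
  by apply: measurableT_comp => //; exact: measurable_enorm.
have /ae_eq_integral_abs : (\int[vol]_(x in punctured) `|(phi (enorm x) * H x)%:E| = 0)%E.
  rewrite -[RHS]I0; apply: eq_integral => x; rewrite inE => x0.
  by rewrite gee0_abs// lee_fin mulr_ge0// ltW// phi0.
move=> /(_ measurable_punctured mphiH) ae0.
rewrite /cone_integral (ae_eq_integral (cst 0%E)) ?integral_cst ?mul0e//.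
- exact: measurable_cone.
- exact: measurable_cone.
- by apply: measurable_funTS; exact/measurable_EFinP.
- apply: filterS ae0 => x /= px0 /andP[x0 _].
  have /eqP := px0 x0; rewrite eqe mulf_eq0 gt_eqF ?phi0//= => /eqP -> //.
Qed.

(** The normalized form of [polar_proportional].  It also holds when the
    normalizing constants are 0, since then both inverses are 0. *)
Lemma polar_ratio G H r (phi : R -> R) : 0 < r ->
  measurable_fun setT G -> (forall x, 0 <= G x) -> homogeneous0 G ->
  measurable_fun setT H -> (forall x, 0 <= H x) -> homogeneous0 H ->
  (cone_integral G r < +oo)%E -> (cone_integral H r < +oo)%E ->
  measurable_fun setT phi -> (forall s, 0 <= phi s) ->
  (forall s, 0 < s -> 0 < phi s) ->
  (\int[vol]_(x in punctured) (phi (enorm x) * H x)%:E < +oo)%E ->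
  ((fine (cone_integral H r))^-1%:E * cone_integral G r =
   (fine (\int[vol]_(x in punctured) (phi (enorm x) * H x)%:E))^-1%:E *
     \int[vol]_(x in punctured) (phi (enorm x) * G x)%:E)%E.
Proof.
move=> r0 mG G0 hG mH H0 hH Goo Hoo mphi phi0 phi1 Ioo.
have := polar_proportional r0 mG G0 hG mH H0 hH Goo Hoo mphi phi0.
set I := (\int[vol]_(x in punctured) (phi (enorm x) * H x)%:E)%E in Ioo *.
set J := (\int[vol]_(x in punctured) (phi (enorm x) * G x)%:E)%E => HJ.
have I0 : (0 <= I)%E.
  by apply: integral_ge0 => x _; rewrite lee_fin mulr_ge0.
have cG0 : (0 <= cone_integral G r)%E by apply: integral_ge0 => x _; rewrite lee_fin.
have cH0 : (0 <= cone_integral H r)%E by apply: integral_ge0 => x _; rewrite lee_fin.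
have fG : cone_integral G r \is a fin_num by rewrite ge0_fin_numE.
have fH : cone_integral H r \is a fin_num by rewrite ge0_fin_numE.
have fI : I \is a fin_num by rewrite ge0_fin_numE.
have [cH|cH] := eqVneq (cone_integral H r) 0%E.
  have -> : I = 0%E by exact: (polar_eq0 r0 mH H0 hH mphi phi0 cH).
  by rewrite cH /= invr0 !mul0e.
have {cH0}cH0 : 0 < fine (cone_integral H r).
  by rewrite fine_gt0// lt0e cH cH0 Hoo.
have nI : fine I != 0.
  apply: contra cH => /eqP I00; apply/eqP; apply: (polar_eq0_inv r mH H0 mphi phi1).
  by rewrite -/I -(fineK fI) I00.
move: HJ; rewrite -(fineK fG) -(fineK fH) -(fineK fI) -!EFinM => HJ.
have -> : J = ((fine (cone_integral H r))^-1 * (fine (cone_integral G r) * fine I))%:E.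
  by rewrite EFinM -HJ muleA -EFinM mulVf ?mul1e// gt_eqF.
by rewrite -!EFinM /=; congr EFin; field; rewrite nI gt_eqF.
Qed.

End polar.

(** * The Vandermonde weight *)

Lemma prod_pairs_const (R : comRingType) n (a : R) :
  \prod_(j < n) \prod_(k < n | (j < k)%N) a = a ^+ 'C(n, 2).
Proof.
rewrite (exchange_big_dep xpredT)//=.
under eq_bigr => k _.
  rewrite (big_ord_narrow (ltnW (ltn_ord k))) prodr_const card_ord.
  over.
by rewrite prodrXr -bin2_sum big_mkord.
Qed.

Lemma natr_bin2 (R : realFieldType) n : ('C(n, 2))%:R = n%:R * (n%:R - 1) / 2 :> R.
Proof.
case: n => [|n]; first by rewrite bin0n mul0r mul0r.
have : ('C(n.+1, 2) * 2)%N = (n.+1 * n)%N.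
  by rewrite mulnC -mul_bin_diag bin1.
move=> /(congr1 (fun k => k%:R : R)); rewrite !natrM -[n.+1%:R]natr1 addrK => h.
by apply: (@mulIf _ 2) => //; rewrite h divfK.
Qed.

Section enorm.
Context {R : realType} (n : nat).
Implicit Types x : Rn R n.

Lemma enorm_ge0 x : 0 <= enorm x. Proof. exact: sqrtr_ge0. Qed.

Lemma sqr_enorm x : enorm x ^+ 2 = \sum_(i < n) tnth x i ^+ 2.
Proof. by rewrite sqr_sqrtr// sumr_ge0// => i _; exact: sqr_ge0. Qed.

Lemma le_coord_enorm x i : `|tnth x i| <= enorm x.
Proof.
rewrite -(ler_pXn2r (ltn0Sn 1)) ?nnegrE ?enorm_ge0//.
rewrite sqr_enorm real_normK ?num_real// (bigD1 i)//= lerDl.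
by apply: sumr_ge0 => j _; exact: sqr_ge0.
Qed.

Lemma radialE r x : radial r x = tscale (r / enorm x) x.
Proof. by []. Qed.

Lemma radial_tscale r c x : 0 < c -> radial r (tscale c x) = radial r x.
Proof.
move=> c0; apply: eq_from_tnth => i.
rewrite !tnth_mktuple enorm_tscale ?ltW// invfM -!mulrA; congr (_ * _).
by rewrite mulrCA mulKf// lt0r_neq0.
Qed.

Lemma enorm_radial r x : 0 <= r -> enorm (radial r x) <= r.
Proof.
move=> r0; rewrite radialE enorm_tscale ?divr_ge0 ?enorm_ge0//.
have [->|x0] := eqVneq (enorm x) 0; first by rewrite mulr0.
by rewrite divfK.
Qed.

Lemma gaussE c x : expR (- c * enorm x ^+ 2) =
  \prod_(i < n) expR (- c * tnth x i ^+ 2).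
Proof. by rewrite sqr_enorm mulr_sumr expR_sum. Qed.

(** Needed only for finiteness: a multiple of this Gaussian dominates the
    weighted density and the indicator of a ball. *)
Lemma integral_gauss_lty c : 0 < c ->
  (\int[@lebesgue_tuple R n]_x (expR (- c * enorm x ^+ 2))%:E < +oo)%E.
Proof.
move=> c0.
under eq_integral do rewrite gaussE.
have mg : measurable_fun setT (fun t : R => expR (- c * t ^+ 2)).
  by apply: measurableT_comp => //; apply: measurable_funM => //; exact: measurable_funX.
rewrite (integral_prod_tuple n mg)//.
have -> : (\int[@lebesgue_measure R]_t (expR (- c * t ^+ 2))%:E =
    (Num.sqrt c)^-1%:E * (Num.sqrt pi)%:E)%E.
  rewrite -integralT_gauss -(ge0_integral_affine 0)//.
  - apply: eq_integral => t _; congr (expR _)%:E.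
    by rewrite addr0 exprMn sqr_sqrtr ?mulNr// ltW.
  - by rewrite sqrtr_gt0.
  - by apply/measurable_EFinP; exact: measurable_gauss_fun.
  - by move=> t; rewrite lee_fin gauss_fun_ge0.
by rewrite -EFinM -EFin_expe ltry.
Qed.

Lemma cone_volume_lty r : (@lebesgue_tuple R n (cone r) < +oo)%E.
Proof.
rewrite -[X in (X < _)%E]mul1e -integral_cst; last exact: measurable_cone.
have mg : measurable_fun setT (fun x : Rn R n => (expR (r ^+ 2) * expR (- 1 * enorm x ^+ 2))%:E).
  apply/measurable_EFinP; apply: measurable_funM => //.
  apply: measurableT_comp => //; apply: measurable_funM => //.
  by apply: measurable_funX; exact: measurable_enorm.
apply: (@le_lt_trans _ _ (\int[@lebesgue_tuple R n]_(x in cone r)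
    (expR (r ^+ 2) * expR (- 1 * enorm x ^+ 2))%:E)%E).
  apply: ge0_le_integral => //=.
  - exact: measurable_cone.
  - exact: measurable_funTS.
  - move=> x /andP[x0 xr]; rewrite lee_fin -expRD -[leLHS]expR0 ler_expR.
    by rewrite mulN1r subr_ge0 ler_pXn2r ?nnegrE ?enorm_ge0// (le_trans (ltW x0)).
apply: (@le_lt_trans _ _ (\int[@lebesgue_tuple R n]_x
    (expR (r ^+ 2) * expR (- 1 * enorm x ^+ 2))%:E)%E).
  apply: ge0_subset_integral => //; first exact: measurable_cone.
under eq_integral do rewrite EFinM.
rewrite ge0_integralZl//.
- rewrite -ge0_fin_numE; last first.
    apply: mule_ge0; first by rewrite lee_fin expR_ge0.
    by apply: integral_ge0 => x _; rewrite lee_fin expR_ge0.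
  rewrite fin_numM// ge0_fin_numE; first exact: integral_gauss_lty.
  by apply: integral_ge0 => x _; rewrite lee_fin expR_ge0.
- apply/measurable_EFinP; apply: measurableT_comp => //; apply: measurable_funM => //.
  by apply: measurable_funX; exact: measurable_enorm.
Qed.

End enorm.

Section vandermonde.
Context {R : realType} (beta : R) (beta_gt0 : 0 < beta) (n : nat).
Implicit Types x : Rn R n.
Local Notation V := (@vandermonde_weight R beta n).
Local Notation vol := (@lebesgue_tuple R n).

(** The degree of homogeneity of the Vandermonde weight. *)
Definition vdegree : R := beta * ('C(n, 2))%:R.
Local Notation d := vdegree.

Lemma vdegree_ge0 : 0 <= d.
Proof. by rewrite mulr_ge0// ltW. Qed.

Lemma powR_vdegree (a : R) : 0 <= a -> (a `^ beta) ^+ 'C(n, 2) = a `^ d.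
Proof. by move=> a0; rewrite -powR_mulrn ?powR_ge0// -powRrM. Qed.

Lemma vandermonde_ge0 x : 0 <= V x.
Proof. by apply: prodr_ge0 => j _; apply: prodr_ge0 => k _; exact: powR_ge0. Qed.

Lemma measurable_vandermonde : measurable_fun setT V.
Proof.
apply: measurable_prod => j _; under eq_fun do rewrite big_mkcond.
apply: measurable_prod => k _; case: (_ < _)%N => //.
apply: (measurableT_comp (@measurable_powR R beta)).
apply: measurableT_comp => //.
by apply: measurable_funB; exact: measurable_tnth.
Qed.

Lemma vandermonde_tscale c x : 0 <= c -> V (tscale c x) = c `^ d * V x.
Proof.
move=> c0; rewrite -powR_vdegree// -prod_pairs_const -big_split/=.
apply: eq_bigr => j _; rewrite -big_split/=; apply: eq_bigr => k _.
by rewrite !tnth_mktuple -mulrBr normrM powRM// ger0_norm.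
Qed.

Lemma vandermonde_le x : V x <= (2 * enorm x) `^ d.
Proof.
have e0 : 0 <= 2 * enorm x by rewrite mulr_ge0// enorm_ge0.
rewrite -powR_vdegree// -prod_pairs_const.
apply: ler_prod => j _; rewrite prodr_ge0 /=; last by move=> k _; exact: powR_ge0.
apply: ler_prod => k _; rewrite powR_ge0 /=.
apply: ge0_ler_powR; rewrite ?nnegrE//; first exact: ltW.
by rewrite (le_trans (ler_normB _ _))// mulr_natl mulr2n lerD// le_coord_enorm.
Qed.

(** The Gaussian parameter is kept free: exponential moments of the squared
    norm under the Hermite law are integrals of this function at another [c]. *)
Definition gvandermonde c x := V x * expR (- c * enorm x ^+ 2).

Lemma measurable_gvandermonde c : measurable_fun setT (gvandermonde c).
Proof.
apply: measurable_funM; first exact: measurable_vandermonde.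
apply: measurableT_comp => //; apply: measurable_funM => //.
by apply: measurable_funX; exact: measurable_enorm.
Qed.

Lemma gvandermonde_ge0 c x : 0 <= gvandermonde c x.
Proof. by rewrite mulr_ge0 ?vandermonde_ge0// expR_ge0. Qed.

Lemma HE_weightE x : HE_weight beta x = gvandermonde 2^-1 x.
Proof.
rewrite /HE_weight /gvandermonde gaussE; congr (_ * _).
by apply: eq_bigr => i _; congr expR; rewrite mulrC mulrN mulNr.
Qed.

Lemma powR_le_expR (a s : R) : 0 <= a -> 0 <= s -> s `^ a <= expR (a * s).
Proof.
move=> a0 s0; rewrite /powR; case: ifPn => [_|s1].
  have [->|an0] := eqVneq a 0; first by rewrite mul0r expR0.
  by rewrite expR_ge0.
rewrite ler_expR ler_wpM2l//.
have {s1} {}s0 : 0 < s by rewrite lt0r s1.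
exact/ltW/ln_sublinear.
Qed.

(** Since [V x <= (2 |x|) `^ d <= expR (2 d |x|)], completing the square absorbs
    the polynomial growth into half of the Gaussian exponent. *)
Lemma gvandermonde_le c x : 0 < c ->
  gvandermonde c x <= expR (2 * d ^+ 2 / c) * expR (- (c / 2) * enorm x ^+ 2).
Proof.
move=> c0; have d0 := vdegree_ge0; have e0 := enorm_ge0 x.
have := vandermonde_le x => /le_trans /(_ (powR_le_expR d0 (mulr_ge0 (ler0n _ 2) e0))) Vle.
apply: (le_trans (ler_wpM2r (expR_ge0 _) Vle)).
rewrite -!expRD ler_expR -subr_ge0.
(* the difference of the two exponents is a perfect square *)
rewrite [X in 0 <= X](_ : _ = (2 * d - c * enorm x) ^+ 2 / (2 * c)).
  by rewrite divr_ge0 ?sqr_ge0// mulr_ge0// ltW.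
by field; exact: lt0r_neq0.
Qed.

Lemma integral_gvandermonde_lty c : 0 < c ->
  (\int[vol]_x (gvandermonde c x)%:E < +oo)%E.
Proof.
move=> c0.
have mg : measurable_fun setT (fun x : Rn R n => (expR (- (c / 2) * enorm x ^+ 2))%:E).
  apply/measurable_EFinP; apply: measurableT_comp => //; apply: measurable_funM => //.
  by apply: measurable_funX; exact: measurable_enorm.
apply: (@le_lt_trans _ _ (\int[vol]_x
  ((expR (2 * d ^+ 2 / c))%:E * (expR (- (c / 2) * enorm x ^+ 2))%:E))%E).
  apply: ge0_le_integral => //=.
  - by move=> x _; rewrite lee_fin gvandermonde_ge0.
  - by apply/measurable_EFinP; exact: measurable_gvandermonde.
  - exact: measurable_funeM.
  - by move=> x _; rewrite -EFinM lee_fin gvandermonde_le.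
rewrite ge0_integralZl//.
have I0 : (0 <= \int[vol]_x (expR (- (c / 2) * enorm x ^+ 2))%:E)%E.
  by apply: integral_ge0 => x _; rewrite lee_fin expR_ge0.
rewrite -ge0_fin_numE ?mule_ge0// ?lee_fin ?expR_ge0// fin_numM//.
by rewrite ge0_fin_numE// integral_gauss_lty// divr_gt0.
Qed.

Lemma integrable_gvandermonde c : 0 < c ->
  vol.-integrable setT (EFin \o gvandermonde c).
Proof.
move=> c0; apply/integrableP; split.
  by apply/measurable_EFinP; exact: measurable_gvandermonde.
under eq_integral do rewrite gee0_abs ?lee_fin ?gvandermonde_ge0//.
exact: integral_gvandermonde_lty.
Qed.

(** Scaling by [expR u] multiplies the Vandermonde weight by [expR (d * u)], the
    volume by [expR (n * u)] and the Gaussian parameter by [expR (2 * u)].  This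
    is the Laplace transform of the chi-squared law of the squared norm. *)
Lemma Rintegral_gvandermonde (c u : R) : 0 < c ->
  \int[vol]_x gvandermonde (c * expR (2 * u)) x =
  expR (- (n%:R + d) * u) * \int[vol]_x gvandermonde c x.
Proof.
move=> c0; have u0 := expR_gt0 u.
have mg := measurable_gvandermonde c.
have g0 := gvandermonde_ge0 c.
have mg' := measurable_gvandermonde (c * expR (2 * u)).
have g0' := gvandermonde_ge0 (c * expR (2 * u)).
have mgE : measurable_fun setT (EFin \o gvandermonde c) by exact/measurable_EFinP.
have mgE' : measurable_fun setT (EFin \o gvandermonde (c * expR (2 * u))).
  exact/measurable_EFinP.
have := ge0_integral_tscale u0 mgE (fun x => g0 x).
have -> : (\int[vol]_x (gvandermonde c (tscale (expR u) x))%:E =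
    (expR u `^ d)%:E * \int[vol]_x (gvandermonde (c * expR (2 * u)) x)%:E)%E.
  rewrite -ge0_integralZl ?lee_fin ?powR_ge0//; last by move=> x _; exact: g0'.
  apply: eq_integral => x _; rewrite -EFinM; congr EFin.
  rewrite /gvandermonde vandermonde_tscale ?(ltW u0)// enorm_tscale ?(ltW u0)//.
  rewrite -mulrA; congr (_ * (_ * expR _)).
  by rewrite exprMn -expRM_natl mulrA !mulNr.
move=> /(congr1 (mule ((expR u `^ d)^-1)%:E)).
rewrite !muleA -!EFinM mulVf ?gt_eqF ?powR_gt0// mul1e => I.
have I0 : (0 <= \int[vol]_x (gvandermonde c x)%:E)%E.
  by apply: integral_ge0 => x _; rewrite lee_fin.
rewrite /Rintegral I fineM//; last by rewrite ge0_fin_numE// integral_gvandermonde_lty.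
congr (_ * _) => /=; rewrite /powR gt_eqF// expRK -exprVn -!expRN -expRM_natl -expRD.
by congr expR; ring.
Qed.

End vandermonde.

(** * Fixed trace integrals as Hermite integrals *)

Lemma ge0_integral_surface_measure (R : realType) n (r : R) (h : Rn R n -> \bar R) :
  0 <= r -> measurable_fun setT h -> (forall x, 0 <= h x)%E ->
  (\int[@surface_measure R n r]_x h x =
   (n%:R / r)%:E * \int[@lebesgue_tuple R n]_(x in cone r) h (radial r x))%E.
Proof.
move=> r0 mh h0.
have nr0 : 0 <= n%:R / r by rewrite divr_ge0.
pose vr := mrestr (@lebesgue_tuple R n) (@measurable_cone R n r).
have mrad := @measurable_radial R n r.
pose nu := measure_function_pushforward__canonical__measure_function_Measure vr mrad.
transitivity ((NngNum nr0)%:num%:E * \int[nu]_x h x)%E.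
  rewrite -ge0_integral_mscale//; apply: eq_measure_integral.
congr (_ * _)%E.
have h0' : {in setT, forall y, 0 <= h y}%E by move=> y _.
apply: (eq_trans (ge0_integral_pushforward mrad vr measurableT mh h0')).
rewrite preimage_setT.
have mhr : measurable_fun setT (h \o radial r) by exact: measurableT_comp.
have h10 (x : Rn R n) : 0 <= \1_(@cone R n r) x :> R by [].
have m1 : measurable_fun setT (\1_(@cone R n r) : Rn R n -> R).
  by apply: measurable_indic; exact: measurable_cone.
have [nu' [nu'E nu'I]] := exists_density_measure (@lebesgue_tuple R n) m1 h10.
transitivity (\int[nu']_x (h \o radial r) x)%E.
  apply: eq_measure_integral => A mA _; rewrite nu'E.
  by rewrite integral_indic//; first rewrite setIC//; exact: measurable_cone.
rewrite nu'I//; last by move=> x; exact: h0.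
rewrite [RHS]integral_mkcond; apply: eq_integral => x _.
by rewrite patchE indicE; case: (x \in _); rewrite ?mule1 ?mule0.
Qed.

Section ensembles.
Context {R : realType} (beta : R) (beta_gt0 : 0 < beta) (n : nat) (n_gt0 : (0 < n)%N).
Local Notation N := n.+1.
Local Notation V := (@vandermonde_weight R beta N).
Local Notation W := (@HE_weight R beta N).
Local Notation Z := (@HE_partition R beta N).
Local Notation vol := (@lebesgue_tuple R N).
Local Notation r := (@FTE_radius R N).
Local Notation d := (vdegree beta N).

Lemma FTE_radiusE : r ^+ 2 = 'C(N, 2)%:R.
Proof. by rewrite /FTE_radius -natr_bin2 sqr_sqrtr. Qed.

Lemma FTE_radius_gt0 : 0 < r.
Proof. by rewrite /FTE_radius -natr_bin2 sqrtr_gt0 ltr0n bin_gt0. Qed.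

Lemma vdegree_gt0 : 0 < d.
Proof. by rewrite mulr_gt0// ltr0n bin_gt0. Qed.

Lemma HE_weight_ge0 (x : Rn R N) : 0 <= W x.
Proof. by rewrite HE_weightE gvandermonde_ge0. Qed.

Lemma measurable_HE_weight : measurable_fun setT W.
Proof.
rewrite (_ : W = gvandermonde beta 2^-1); first exact: measurable_gvandermonde.
by apply/funext => x; exact: HE_weightE.
Qed.

Lemma HE_partitionE : (\int[vol]_x (W x)%:E)%E = Z%:E.
Proof.
rewrite /HE_partition /Rintegral fineK//.
under eq_integral do rewrite HE_weightE.
rewrite ge0_fin_numE; first by apply: integral_gvandermonde_lty; rewrite ?invr_gt0.
by apply: integral_ge0 => x _; rewrite lee_fin gvandermonde_ge0.
Qed.

Lemma HE_partition_ge0 : 0 <= Z.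
Proof. by apply: Rintegral_ge0 => x _; exact: HE_weight_ge0. Qed.

Lemma tuple_head (x : Rn R N) : head 0 (x : seq R) = tnth x ord0.
Proof. by rewrite (tnth_nth 0) nth0. Qed.

(** The radial factor of the Hermite weight, normalized so that the remaining
    angular factor is the Vandermonde weight on the sphere of radius [r]; see
    [radial_profileE]. *)
Definition radial_profile (s : R) : R := (s / r) `^ d * expR (- 2^-1 * s ^+ 2).

Lemma radial_profileE (x : Rn R N) : 0 < enorm x ->
  radial_profile (enorm x) * V (radial r x) = W x.
Proof.
move=> x0; rewrite HE_weightE /gvandermonde /radial_profile radialE.
have r0 := FTE_radius_gt0.
have q0 : 0 <= r / enorm x by rewrite divr_ge0 ?ltW.
rewrite vandermonde_tscale// -/d mulrACA -powRM//; last by rewrite divr_ge0 ?ltW.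
rewrite (_ : enorm x / r * (r / enorm x) = 1); last by field; rewrite !gt_eqF.
by rewrite powR1 mul1r mulrC.
Qed.

Lemma HE_weight_eq0 (x : Rn R N) : ~ (0 < enorm x) -> W x = 0.
Proof.
move=> x0; have {}x0 : enorm x = 0.
  by apply/eqP; apply: contra_notT x0 => x0; rewrite lt0r x0 enorm_ge0.
rewrite HE_weightE; apply/eqP; rewrite eq_le gvandermonde_ge0 andbT.
rewrite /gvandermonde x0 pmulr_lle0 ?expR_gt0//.
apply: (le_trans (vandermonde_le beta_gt0 x)).
by rewrite x0 mulr0 powR0// gt_eqF// vdegree_gt0.
Qed.

Lemma measurable_radial_profile : measurable_fun setT radial_profile.
Proof.
apply: measurable_funM; last by apply: measurableT_comp => //; exact: measurable_funM.
by apply: (measurableT_comp (@measurable_powR R d)); exact: measurable_funM.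
Qed.

Lemma radial_profile_ge0 s : 0 <= radial_profile s.
Proof. by rewrite mulr_ge0 ?powR_ge0 ?expR_ge0. Qed.

Lemma radial_profile_gt0 s : 0 < s -> 0 < radial_profile s.
Proof.
move=> s0; rewrite mulr_gt0 ?expR_gt0// powR_gt0// divr_gt0//.
exact: FTE_radius_gt0.
Qed.

Lemma integral_radial_profile (g : Rn R N -> R) :
  (\int[vol]_(x in @punctured R N)
     (radial_profile (enorm x) * (g (radial r x) * V (radial r x)))%:E =
   \int[vol]_x (g (radial r x) * W x)%:E)%E.
Proof.
rewrite [LHS]integral_mkcond; apply: eq_integral => x _.
rewrite patchE /punctured; case: ifPn; rewrite ?inE ?notin_setE /= => x0.
  by rewrite -radial_profileE// mulrCA.
by rewrite HE_weight_eq0// mulr0.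
Qed.

Lemma vandermonde_radial_le (x : Rn R N) : V (radial r x) <= (2 * r) `^ d.
Proof.
apply: (le_trans (vandermonde_le beta_gt0 _)).
have r0 := ltW FTE_radius_gt0.
apply: ge0_ler_powR; rewrite ?nnegrE ?vdegree_ge0 ?(mulr_ge0 _ (enorm_ge0 _))//.
  by rewrite mulr_ge0.
by rewrite ler_pM2l// enorm_radial.
Qed.

Lemma cone_integral_radial_lty (g : Rn R N -> R) C :
  measurable_fun setT g -> (forall x, 0 <= g x <= C) ->
  (cone_integral (fun x => g (radial r x) * V (radial r x))%R r < +oo)%E.
Proof.
move=> mg gC.
have C0 : 0 <= C.
  by have /andP[g0 /(le_trans g0)] := gC [tuple 0 | i < N].
have mrad := @measurable_radial R N r.
have mG : measurable_fun setT (fun x : Rn R N => g (radial r x) * V (radial r x)).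
  apply: measurable_funM; apply: measurableT_comp => //.
  exact: measurable_vandermonde.
apply: (@le_lt_trans _ _ (\int[vol]_(x in cone r) (C * (2 * r) `^ d)%:E)%E).
  apply: ge0_le_integral => //.
  - exact: measurable_cone.
  - by move=> x _; rewrite lee_fin mulr_ge0 ?vandermonde_ge0//; case/andP: (gC (radial r x)).
  - by apply: measurable_funTS; exact/measurable_EFinP.
  - move=> x _; rewrite lee_fin ler_pM ?vandermonde_ge0 ?vandermonde_radial_le//;
    by case/andP: (gC (radial r x)).
rewrite integral_cst; last exact: measurable_cone.
rewrite lte_mul_pinfty ?lee_fin ?mulr_ge0 ?powR_ge0//.
exact: cone_volume_lty.
Qed.

(** The fixed trace law is the law of [radial r x] under the Hermite law: both
    sides are ratios of integrals of the 0-homogeneous functions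
    [g (radial r x) * V (radial r x)] and [V (radial r x)], against the indicator
    of a ball on the left and against [radial_profile] on the right, so
    [polar_ratio] applies. *)
Lemma FTE_HE_ratio (g : Rn R N -> R) C :
  measurable_fun setT g -> (forall x, 0 <= g x <= C) ->
  ((FTE_partition beta N)^-1%:E *
     \int[@surface_measure R N r]_x (g x * V x)%:E =
   (Z^-1)%:E * \int[vol]_x (g (radial r x) * W x)%:E)%E.
Proof.
move=> mg gC; have r0 := FTE_radius_gt0.
have mV := @measurable_vandermonde R beta N.
have V0 := @vandermonde_ge0 R beta N.
have mrad := @measurable_radial R N r.
have g0 x : 0 <= g x by case/andP: (gC x).
have Nr0 : 0 < N%:R / r by rewrite divr_gt0.
have surfE (h : Rn R N -> R) : measurable_fun setT h -> (forall x, 0 <= h x) ->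
    (\int[@surface_measure R N r]_x (h x * V x)%:E = (N%:R / r)%:E *
      cone_integral (fun x => h (radial r x) * V (radial r x))%R r)%E.
  move=> mh h0; rewrite ge0_integral_surface_measure ?(ltW r0)//.
  - by apply/measurable_EFinP; exact: measurable_funM.
  - by move=> x; rewrite lee_fin mulr_ge0.
have part1 : FTE_partition beta N = N%:R / r *
    fine (cone_integral (fun x : Rn R N => 1 * V (radial r x)) r).
  rewrite /FTE_partition /Rintegral.
  under eq_integral do rewrite -[V _]mul1r.
  rewrite (surfE (fun=> 1))// fineM// ge0_fin_numE.
    by apply: (@cone_integral_radial_lty (fun=> 1) 1) => // x; rewrite ler01 lexx.
  by apply: integral_ge0 => x _; rewrite lee_fin mul1r.
rewrite surfE// part1.
set M := fine (cone_integral (fun x : Rn R N => 1 * V (radial r x)) r).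
rewrite muleA -EFinM (_ : (N%:R / r * M)^-1 * (N%:R / r) = M^-1); last first.
  by rewrite invfM mulrAC mulVf ?mul1r// gt_eqF.
have hom (h : Rn R N -> R) : homogeneous0 (fun x => h (radial r x) * V (radial r x)).
  by move=> c x c0; rewrite radial_tscale.
have mh (h : Rn R N -> R) : measurable_fun setT h ->
    measurable_fun setT (fun x => h (radial r x) * V (radial r x)).
  by move=> ?; apply: measurable_funM; exact: measurableT_comp.
rewrite (polar_ratio r0 (mh _ mg) _ (hom g) (mh (fun=> 1) _) _ (hom (fun=> 1))
  (cone_integral_radial_lty mg gC) _
  measurable_radial_profile radial_profile_ge0 radial_profile_gt0)//.
- rewrite integral_radial_profile (integral_radial_profile (fun=> 1)).
  by under eq_integral do rewrite mul1r; rewrite HE_partitionE.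
- by move=> x; rewrite mulr_ge0.
- by move=> x; rewrite mul1r.
- by apply: (@cone_integral_radial_lty (fun=> 1) 1) => // x; rewrite ler01 lexx.
- rewrite (integral_radial_profile (fun=> 1)).
  by under eq_integral do rewrite mul1r; rewrite HE_partitionE ltry.
Qed.

Lemma ge0_integral_FTE_density (rho : R -> R) (g : R -> R) C :
  is_FTE_eigenvalue_density beta N rho ->
  measurable_fun setT g -> (forall x, 0 <= g x <= C) ->
  (\int[@lebesgue_measure R]_x (g x * rho x)%:E =
   \int[vol]_x (g (tnth (radial r x) ord0) * (Z^-1 * W x))%:E)%E.
Proof.
move=> [mrho rho0 rhoE] mg gC.
have mV := @measurable_vandermonde R beta N.
have V0 := @vandermonde_ge0 R beta N.
have g0 x : 0 <= g x by case/andP: (gC x).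
have mh : measurable_fun setT (fun x : Rn R N => tnth x ord0) by exact: measurable_tnth.
have Zf0 : 0 <= (FTE_partition beta N)^-1.
  by rewrite invr_ge0; apply: Rintegral_ge0 => x _; exact: V0.
have Zi0 : 0 <= Z^-1 by rewrite invr_ge0 HE_partition_ge0.
transitivity (\int[@surface_measure R N r]_x
    (g (tnth x ord0) * ((FTE_partition beta N)^-1 * V x))%:E)%E.
  under eq_integral do rewrite EFinM.
  rewrite (@density_transfer _ _ _ _ _ _ (@surface_measure R N r)
    (fun x => tnth x ord0) rho (fun x => (FTE_partition beta N)^-1 * V x) _ _ mh)//.
  - by move=> x; rewrite mulr_ge0.
  - exact: measurable_funM.
  - move=> B mB; rewrite -rhoE//.
    under eq_integral do rewrite EFinM.
    rewrite ge0_integralZl//.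
    + rewrite /FTE (_ : [set x | _] = (fun x : Rn R N => tnth x ord0) @^-1` B)//.
      by apply/funext => x /=; rewrite tuple_head.
    + by rewrite -[X in measurable X]setTI; exact: mh.
    + by apply: measurable_funTS; exact/measurable_EFinP.
    + by move=> x _; rewrite lee_fin.
  - exact/measurable_EFinP.
have mgh : measurable_fun setT (fun x : Rn R N => g (tnth x ord0)).
  exact: measurableT_comp.
have mgr : measurable_fun setT (fun x : Rn R N => g (tnth (radial r x) ord0)).
  by apply: (measurableT_comp mgh); exact: measurable_radial.
under eq_integral do rewrite mulrCA EFinM.
rewrite ge0_integralZl//; last 2 first.
- by apply/measurable_EFinP; exact: measurable_funM.
- by move=> x _; rewrite lee_fin mulr_ge0.
rewrite (FTE_HE_ratio mgh (fun x => gC _)).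
rewrite -ge0_integralZl//; last 2 first.
- by apply/measurable_EFinP/measurable_funM => //; exact: measurable_HE_weight.
- by move=> x _; rewrite lee_fin mulr_ge0// HE_weight_ge0.
by apply: eq_integral => x _; rewrite -EFinM mulrCA.
Qed.

End ensembles.

(** * Hermite eigenvalue density *)

Section HE.
Context {R : realType} (beta : R) (beta_gt0 : 0 < beta) (n : nat).
Local Notation N := n.+1.
Local Notation W := (@HE_weight R beta N).
Local Notation Z := (@HE_partition R beta N).
Local Notation vol := (@lebesgue_tuple R N).
Local Notation HE := (@HE_density R beta N).
Local Notation rho := (HE_eigenvalue_density beta N).

Lemma HE_density_ge0 (x : Rn R N) : 0 <= HE x.
Proof. by rewrite mulr_ge0 ?HE_weight_ge0// invr_ge0 HE_partition_ge0. Qed.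

Lemma measurable_HE_density : measurable_fun setT HE.
Proof. by apply: measurable_funM => //; exact: measurable_HE_weight. Qed.

Lemma integral_HE_density_lty : (\int[vol]_x (HE x)%:E < +oo)%E.
Proof.
under eq_integral do rewrite EFinM.
rewrite ge0_integralZl//.
- by rewrite HE_partitionE// -EFinM ltry.
- by apply/measurable_EFinP; exact: measurable_HE_weight.
- by move=> x _; rewrite lee_fin HE_weight_ge0.
- by rewrite lee_fin invr_ge0 HE_partition_ge0.
Qed.

Let mHEE : measurable_fun setT (EFin \o HE).
Proof. by apply/measurable_EFinP; exact: measurable_HE_density. Qed.

Let mHEc : measurable_fun setT ((EFin \o HE) \o @tcons R n).
Proof. by apply: measurableT_comp => //; exact: measurable_tcons. Qed.

Let HEE0 x : (0 <= ((EFin \o HE) \o @tcons R n) x)%E.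
Proof. by rewrite lee_fin HE_density_ge0. Qed.

Let F (x : R) := (\int[@lebesgue_tuple R n]_y (HE (tcons (x, y)))%:E)%E.

Let mF : measurable_fun setT F.
Proof.
exact: (@measurable_fun_fubini_tonelli_F _ _ _ _ _ (@lebesgue_tuple R n) _ mHEc HEE0).
Qed.

Let F0 x : (0 <= F x)%E.
Proof. by apply: integral_ge0 => y _; rewrite lee_fin HE_density_ge0. Qed.

Lemma HE_eigenvalue_density_ge0 x : 0 <= rho x.
Proof. by apply: fine_ge0; exact: F0. Qed.

Lemma measurable_HE_eigenvalue_density : measurable_fun setT rho.
Proof. by apply: measurableT_comp => //; exact: mF. Qed.

(** Fubini, with one subtlety: the eigenvalue density is the value by [fine] of
    an extended real integral, which agrees with that integral only where it is
    finite, that is almost everywhere by integrability. *)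
Lemma ge0_integral_HE_density (g : R -> R) :
  measurable_fun setT g -> (forall x, 0 <= g x) ->
  (\int[@lebesgue_measure R]_x (g x * rho x)%:E =
   \int[vol]_x (g (tnth x ord0) * (Z^-1 * W x))%:E)%E.
Proof.
move=> mg g0.
have mgh : measurable_fun setT (fun x : Rn R N => g (tnth x ord0)).
  by apply: measurableT_comp => //; exact: measurable_tnth.
rewrite [RHS]ge0_integral_lebesgue_tupleS; last 2 first.
- apply/measurable_EFinP; apply: measurable_funM => //.
  exact: measurable_HE_density.
- by move=> x; rewrite lee_fin mulr_ge0// HE_density_ge0.
transitivity (\int[@lebesgue_measure R]_x ((g x)%:E * F x))%E; last first.
  apply: eq_integral => x _; rewrite /F -ge0_integralZl ?lee_fin//.
  - exact: (measurableT_comp mHEc).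
  - by move=> y _; rewrite lee_fin HE_density_ge0.
have Foo : (\int[@lebesgue_measure R]_x F x < +oo)%E.
  have := integral_HE_density_lty.
  by rewrite (ge0_integral_lebesgue_tupleS mHEE)// => x; rewrite lee_fin HE_density_ge0.
have iF : (@lebesgue_measure R).-integrable setT F.
  apply/integrableP; split => //.
  by under eq_integral do rewrite gee0_abs//.
apply: ae_eq_integral => //.
- apply/measurable_EFinP/measurable_funM => //.
  exact: measurable_HE_eigenvalue_density.
- by apply: emeasurable_funM => //; exact/measurable_EFinP.
- apply: filterS (integrable_ae measurableT iF) => x /= Fx _.
  by rewrite EFinM; congr (_ * _)%E; rewrite -[RHS](fineK (Fx Logic.I)).
Qed.

End HE.

(** [b] and [a] are the position and the width of the window through which the
    density is observed, [psi] a random variable whose law has density [rho]. *)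
Lemma Rintegral_rescaled_density (R : realType) d (T : measurableType d)
    (mu : {measure set T -> \bar R}) (psi : T -> R) (w : T -> R) (rho : R -> R)
    (K a b C : R) :
  0 <= K -> 0 < a -> measurable_fun setT psi -> measurable_fun setT w ->
  measurable_fun setT rho ->
  (forall x, 0 <= rho x) -> (forall x, 0 <= w x) ->
  (forall g : R -> R, measurable_fun setT g -> (forall x, 0 <= g x <= C) ->
    (\int[@lebesgue_measure R]_x (g x * rho x)%:E = \int[mu]_x (g (psi x) * w x)%:E)%E) ->
  forall f : R -> R, measurable_fun setT f -> (forall x, `|f x| <= C) ->
  \int[@lebesgue_measure R]_t (f t * (K * rho (a * t + b))) =
  \int[mu]_x (f ((psi x - b) / a) * (K / a * w x)).
Proof.
move=> K0 a0 mpsi mw mrho rho0 w0 H f mf fC.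
have Ka0 : 0 <= K / a by rewrite divr_ge0// ltW.
have TR := @Rintegral_transfer _ _ _ _ _ (@lebesgue_measure R) mu
  (fun x => (psi x - b) / a)
  (fun t => K * rho (a * t + b)) (fun x => K / a * w x) _ _ C.
apply: TR => //.
- by move=> x; rewrite mulr_ge0.
- by move=> x; rewrite mulr_ge0.
move=> g mg gC.
have g0 x : 0 <= g x by case/andP: (gC x).
have mga : measurable_fun setT (fun x : R => g ((x - b) / a)).
  by apply: measurableT_comp => //; apply: measurable_funM => //; exact: measurable_funB.
have mgpsi : measurable_fun setT (fun x => g ((psi x - b) / a)).
  exact: (measurableT_comp mga).
transitivity (\int[@lebesgue_measure R]_t
    (fun x : R => (g ((x - b) / a) * (K * rho x))%:E) (a * t + b)%R)%E.
  by apply: eq_integral => t _ /=; rewrite addrK mulrAC mulfV ?mul1r// gt_eqF.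
rewrite (@ge0_integral_affine R a b (fun x : R => (g ((x - b) / a) * (K * rho x))%:E))//; last 2 first.
- by apply/measurable_EFinP; apply: measurable_funM => //; exact: measurable_funM.
- by move=> x; rewrite lee_fin !mulr_ge0.
have -> : (\int[@lebesgue_measure R]_x (g ((x - b) / a) * (K * rho x))%:E =
    K%:E * \int[@lebesgue_measure R]_x (g ((x - b) / a) * rho x)%:E)%E.
  rewrite -ge0_integralZl//; last 2 first.
  - by apply/measurable_EFinP; exact: measurable_funM.
  - by move=> x _; rewrite lee_fin mulr_ge0.
  by apply: eq_integral => x _; rewrite -EFinM mulrCA.
have /= -> := H (fun x : R => g ((x - b) / a)) mga (fun x => gC _).
rewrite muleA -EFinM [a^-1 * K]mulrC -ge0_integralZl//; last 2 first.
- by apply/measurable_EFinP; exact: measurable_funM.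
- by move=> x _; rewrite lee_fin mulr_ge0.
by apply: eq_integral => x _; rewrite -EFinM mulrCA.
Qed.

(** * Concentration of the norm *)

Lemma opp_ln1B_le (R : realType) (mu : R) : `|mu| <= 2^-1 ->
  - ln (1 - mu) <= mu + 2 * mu ^+ 2.
Proof.
rewrite ler_norml => /andP[m1 m2].
have m0 : 0 < 1 - mu by lra.
rewrite -lnV//.
have := @le_ln1Dx R ((1 - mu)^-1 - 1).
rewrite addrCA subrr addr0 => le1.
apply: (le_trans (le1 _)).
  by rewrite ltrBrDr addNr invr_gt0.
rewrite -(ler_pM2r m0) mulrBl mulVf ?gt_eqF// mul1r.
have := sqr_ge0 mu => m3; nra.
Qed.

(** [u - v] is [U - 1] times [v + 2q], or [1 - 1/U] times [u + 2q], and one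
    of the two is controlled; the factor 2 pays for dividing by [U >= 1/2]. *)
Lemma rescaling_close (R : realFieldType) (q u v U M delta : R) :
  0 < q -> 2 * q + u = U * (2 * q + v) -> `|U - 1| <= delta -> delta <= 2^-1 ->
  `|u| <= M \/ `|v| <= M -> `|u - v| <= 2 * delta * (M + 2 * q).
Proof.
move=> q0 uv Ud d2 [uM|vM].
(* here U (u - v) = (U - 1) (u + 2q), and U >= 1/2 is divided out *)
- have U0 : 2^-1 <= U by move: Ud; rewrite ler_norml => /andP[]; lra.
  have E : U * (u - v) = (U - 1) * (u + 2 * q) by nra.
  have M0 := le_trans (normr_ge0 _) uM.
  have : `|U| * `|u - v| <= delta * (M + 2 * q).
    rewrite -normrM E normrM ler_pM//.
    by rewrite (le_trans (ler_normD _ _))// lerD// ger0_norm// mulr_ge0 ?ltW.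
  rewrite (ger0_norm (le_trans _ U0))// => H.
  have := normr_ge0 (u - v); nra.
- have E : u - v = (U - 1) * (v + 2 * q) by nra.
  have M0 := le_trans (normr_ge0 _) vM.
  have d0 := le_trans (normr_ge0 _) Ud.
  have k0 : 0 <= delta * (M + 2 * q) by rewrite mulr_ge0// addr_ge0// mulr_ge0 ?ltW.
  rewrite E normrM (@le_trans _ _ (delta * (M + 2 * q)))//; last by lra.
  rewrite ler_pM//.
  by rewrite (le_trans (ler_normD _ _))// lerD// ger0_norm// mulr_ge0 ?ltW.
Qed.

Lemma norm_sub1_le_sqr (R : realFieldType) (U delta : R) : 0 <= U ->
  `|U ^+ 2 - 1| <= delta -> `|U - 1| <= delta.
Proof.
move=> U0; apply: le_trans.
rewrite (_ : U ^+ 2 - 1 = (U - 1) * (U + 1)); last by ring.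
by rewrite normrM ler_peMr// ger0_norm; lra.
Qed.

Section exponential_tilting.
Context {R : realType} (beta : R) (beta_gt0 : 0 < beta) (n : nat).
Local Notation vol := (@lebesgue_tuple R n).
Local Notation W := (@HE_weight R beta n).
Local Notation Z := (@HE_partition R beta n).
Local Notation d := (vdegree beta n).

(** An exponential that is at least 1 when the squared norm exceeds
    [(1 + delta) * d], for positive [delta], or falls below it, for negative
    [delta]; both tails of the norm are thus bounded by one formula.  The rate
    [delta / 4] makes the quadratic terms in [HE_chernoff] leave a negative
    multiple of [d * delta ^+ 2]. *)
Definition tilt (delta : R) (x : Rn R n) : R :=
  expR (delta / 4 * (enorm x ^+ 2 - (1 + delta) * d) / 2).

Lemma tilt_HE_weight delta x : tilt delta x * W x =
  expR (- (delta / 4 * (1 + delta) * d / 2)) * gvandermonde beta (2^-1 * (1 - delta / 4)) x.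
Proof.
rewrite HE_weightE /gvandermonde /tilt mulrCA [RHS]mulrCA; congr (_ * _).
by rewrite -!expRD; congr expR; field.
Qed.

Lemma integrable_tilt delta : `|delta| <= 2^-1 ->
  vol.-integrable setT (fun x => (tilt delta x * W x)%:E).
Proof.
rewrite ler_norml => /andP[d1 d2].
under eq_fun do rewrite tilt_HE_weight EFinM.
by apply: integrableZl => //; apply: integrable_gvandermonde => //; lra.
Qed.

(** Multiplying by [tilt] only changes the Gaussian parameter by the factor
    [1 - delta / 4], so the integral is explicit; the logarithm is then expanded
    to second order.  The terms linear in [delta] with coefficient [d] cancel,
    those with coefficient [n] remain. *)
Lemma HE_chernoff delta : `|delta| <= 2^-1 ->
  \int[vol]_x (tilt delta x * W x) <= expR (- (d * delta ^+ 2 / 16) + n%:R * `|delta|) * Z.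
Proof.
move=> delta2; have /andP[d1 d2] : - 2^-1 <= delta <= 2^-1 by rewrite -ler_norml.
under eq_Rintegral do rewrite tilt_HE_weight.
have m0 : 0 < 1 - delta / 4 by lra.
rewrite RintegralZl//; last by apply: integrable_gvandermonde => //; lra.
(* the form in which Rintegral_gvandermonde expects the factor *)
have -> : 1 - delta / 4 = expR (2 * (ln (1 - delta / 4) / 2)).
  by rewrite [2 * _]mulrC divfK// lnK// posrE.
rewrite Rintegral_gvandermonde//.
have -> : \int[vol]_x gvandermonde beta 2^-1 x = Z.
  by apply: eq_Rintegral => x _; rewrite HE_weightE.
rewrite mulrA -expRD ler_wpM2r//.
  by apply: Rintegral_ge0 => x _; rewrite HE_weightE gvandermonde_ge0.
rewrite ler_expR.
have dge0 : 0 <= d by exact: vdegree_ge0.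
have m4 : `|delta / 4| <= 2^-1 by rewrite ler_norml; apply/andP; split; lra.
have ln1 := opp_ln1B_le m4.
have nd : 0 <= n%:R + d by rewrite addr_ge0.
have n0 : 0 <= n%:R :> R by [].
have step : - (n%:R + d) * (ln (1 - delta / 4) / 2) <= (n%:R + d) / 2 * (delta / 4 + 2 * (delta / 4) ^+ 2).
  rewrite [leLHS](_ : _ = (n%:R + d) / 2 * - ln (1 - delta / 4)); last by field.
  by rewrite ler_wpM2l// divr_ge0.
apply: (le_trans (lerD (lexx _) step)).
have an : delta <= `|delta| by exact: ler_norm.
have a0 := normr_ge0 delta.
have : delta / 4 + 2 * (delta / 4) ^+ 2 <= `|delta|.
  have : delta ^+ 2 = `|delta| ^+ 2 by rewrite real_normK ?num_real.
  nra.
move=> /(ler_wpM2l n0) np; have na := mulr_ge0 n0 a0.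
rewrite -subr_ge0; set p := delta / 4 + _ in np *.
rewrite [leRHS](_ : _ = n%:R * `|delta| - n%:R * p / 2); first by lra.
by rewrite /p; field.
Qed.

End exponential_tilting.

(** * Edge variables *)

Section edge.
Context {R : realType}.

(** The [t] such that [u = A * (1 + t / (2 * N `^ (2 / 3)))]. *)
Definition edge_coord (N : nat) (A u : R) : R :=
  2 * N%:R `^ (2 / 3) * (u / A - 1).

Lemma powR_edge_exponents (N : nat) : (0 < N)%N ->
  N%:R `^ (5 / 6) * N%:R `^ (2 / 3) = N%:R * Num.sqrt N%:R :> R.
Proof.
move=> N0; have N1 : (N%:R : R) != 0 by rewrite pnatr_eq0 -lt0n.
rewrite -powRD; last by rewrite N1 implybT.
rewrite -powR12_sqrt// -[X in _ = X * _]powRr1// -powRD; last by rewrite N1 implybT.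
by congr (_ `^ _); field.
Qed.

(** The prefactor of the rescaled density divided by the width of the window is
    [N], for either ensemble ([b = beta] or [b = 1]): the rescaled densities
    count eigenvalues, they are not probability densities. *)
Lemma edge_prefactor (N : nat) (b : R) : (0 < N)%N -> 0 < b ->
  Num.sqrt b * N%:R `^ (5 / 6) / Num.sqrt 2 /
    (Num.sqrt (2 * b * N%:R) / (2 * N%:R `^ (2 / 3))) = N%:R.
Proof.
move=> N0 b0; have N1 : 0 < (N%:R : R) by rewrite ltr0n.
have sb : 0 < Num.sqrt b by rewrite sqrtr_gt0.
have sN : 0 < Num.sqrt (N%:R : R) by rewrite sqrtr_gt0.
have s2 : 0 < Num.sqrt (2 : R) by rewrite sqrtr_gt0.
have q0 : 0 < N%:R `^ (2 / 3) :> R by rewrite powR_gt0.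
rewrite !sqrtrM ?mulr_ge0 ?(ltW b0)//.
have -> : Num.sqrt b * N%:R `^ (5 / 6) / Num.sqrt 2 /
    (Num.sqrt 2 * Num.sqrt b * Num.sqrt N%:R / (2 * N%:R `^ (2 / 3))) =
    2 * (N%:R `^ (5 / 6) * N%:R `^ (2 / 3)) / (Num.sqrt 2 ^+ 2 * Num.sqrt N%:R).
  by field; rewrite !gt_eqF.
by rewrite powR_edge_exponents// sqr_sqrtr//; field; rewrite gt_eqF.
Qed.

Lemma Rintegral_edge d (T : measurableType d) (mu : {measure set T -> \bar R})
    (psi : T -> R) (w : T -> R) (rho : R -> R) (N : nat) (K A C : R) :
  (0 < N)%N -> 0 <= K -> 0 < A -> K / (A / (2 * N%:R `^ (2 / 3))) = N%:R ->
  measurable_fun setT psi -> measurable_fun setT w ->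
  measurable_fun setT rho ->
  (forall x, 0 <= rho x) -> (forall x, 0 <= w x) ->
  (forall g : R -> R, measurable_fun setT g -> (forall x, 0 <= g x <= C) ->
    (\int[@lebesgue_measure R]_x (g x * rho x)%:E = \int[mu]_x (g (psi x) * w x)%:E)%E) ->
  forall f : R -> R, measurable_fun setT f -> (forall x, `|f x| <= C) ->
  \int[@lebesgue_measure R]_t
    (f t * (K * rho (A * (1 + t / (2 * N%:R `^ (2 / 3)))))) =
  \int[mu]_x (f (edge_coord N A (psi x)) * (N%:R * w x)).
Proof.
move=> N0 K0 A0 KA mpsi mw mrho rho0 w0 H f mf fC.
have q0 : 0 < N%:R `^ (2 / 3) :> R by rewrite powR_gt0// ltr0n.
have a0 : 0 < A / (2 * N%:R `^ (2 / 3)) by rewrite divr_gt0// mulr_gt0.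
transitivity (\int[@lebesgue_measure R]_t
    (f t * (K * rho (A / (2 * N%:R `^ (2 / 3)) * t + A)))).
  apply: eq_Rintegral => t _; congr (_ * (_ * rho _)).
  by rewrite mulrDr mulr1 addrC; congr (_ + _); rewrite mulrA mulrAC.
rewrite (Rintegral_rescaled_density A K0 a0 mpsi mw mrho rho0 w0 H mf fC) KA.
apply: eq_Rintegral => x _; congr (f _ * _); rewrite /edge_coord.
by field; rewrite !gt_eqF.
Qed.

End edge.

Section comparison.
Context {R : realType} (beta : R) (beta_gt0 : 0 < beta) (n : nat) (n_gt0 : (0 < n)%N).
Local Notation N := n.+1.
Local Notation W := (@HE_weight R beta N).
Local Notation Z := (@HE_partition R beta N).
Local Notation vol := (@lebesgue_tuple R N).
Local Notation r := (@FTE_radius R N).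
Local Notation d := (vdegree beta N).
Local Notation q := (N%:R `^ (2 / 3) : R).

Definition HE_edge (x : Rn R N) : R :=
  edge_coord N (Num.sqrt (2 * beta * N%:R)) (tnth x ord0).

Definition FTE_edge (x : Rn R N) : R :=
  edge_coord N (Num.sqrt (2 * N%:R)) (tnth (radial r x) ord0).

(** The Hermite probability density times the number of eigenvalues. *)
Definition HE_normalized (x : Rn R N) : R := N%:R * (Z^-1 * W x).
Local Notation w := HE_normalized.

Lemma measurable_HE_edge : measurable_fun setT HE_edge.
Proof.
apply: measurable_funM => //; apply: measurable_funB => //.
by apply: measurable_funM => //; exact: measurable_tnth.
Qed.

Lemma measurable_FTE_edge : measurable_fun setT FTE_edge.
Proof.
apply: measurable_funM => //; apply: measurable_funB => //.
apply: measurable_funM => //.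
apply: (measurableT_comp (f := fun y : Rn R N => tnth y ord0) (g := radial r)).
  exact: measurable_tnth.
exact: measurable_radial.
Qed.

Lemma Rintegral_HE_edge (f : R -> R) C :
  measurable_fun setT f -> (forall x, `|f x| <= C) ->
  \int[@lebesgue_measure R]_t
    (f t * (Num.sqrt beta * N%:R `^ (5 / 6) / Num.sqrt 2 *
      HE_eigenvalue_density beta N
        (Num.sqrt (2 * beta * N%:R) * (1 + t / (2 * N%:R `^ (2 / 3)))))) =
  \int[vol]_x (f (HE_edge x) * w x).
Proof.
move=> mf fC.
apply: (@Rintegral_edge _ _ _ vol (fun x => tnth x ord0) (fun x => Z^-1 * W x) _ N _ _ C) => //.
- by rewrite sqrtr_gt0 !mulr_gt0.
- exact: edge_prefactor.
- exact: measurable_tnth.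
- exact: measurable_HE_density.
- exact: measurable_HE_eigenvalue_density.
- exact: HE_eigenvalue_density_ge0.
- exact: HE_density_ge0.
- move=> g mg gC; apply: ge0_integral_HE_density => // x.
  by case/andP: (gC x).
Qed.

Lemma Rintegral_FTE_edge (rho : R -> R) (f : R -> R) C :
  is_FTE_eigenvalue_density beta N rho ->
  measurable_fun setT f -> (forall x, `|f x| <= C) ->
  \int[@lebesgue_measure R]_x
    (f x * (N%:R `^ (5 / 6) / Num.sqrt 2 *
      rho (Num.sqrt (2 * N%:R) * (1 + x / (2 * N%:R `^ (2 / 3)))))) =
  \int[vol]_x (f (FTE_edge x) * w x).
Proof.
move=> rhoD mf fC; have [mrho rho0 _] := rhoD.
apply: (@Rintegral_edge _ _ _ vol (fun x => tnth (radial r x) ord0)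
  (fun x => Z^-1 * W x) _ N _ _ C) => //.
- have := @edge_prefactor R N 1 isT ltr01.
  by rewrite sqrtr1 mul1r mulr1.
- apply: (measurableT_comp (f := fun y : Rn R N => tnth y ord0) (g := radial r)).
    exact: measurable_tnth.
  exact: measurable_radial.
- exact: measurable_HE_density.
- exact: HE_density_ge0.
- by move=> g mg gC; exact: (ge0_integral_FTE_density _ _ rhoD mg gC).
Qed.

Lemma HE_normalized_ge0 x : 0 <= w x.
Proof. by rewrite mulr_ge0// HE_density_ge0. Qed.

(** The first coordinates of [x] and of [radial r x] differ by the factor
    [enorm x / r], and the two edges differ by the factor [Num.sqrt beta]. *)
Lemma edge_relation (x : Rn R N) : 0 < enorm x ->
  2 * q + HE_edge x =
  Num.sqrt (enorm x ^+ 2 / d) * (2 * q + FTE_edge x).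
Proof.
move=> x0; have r0 : 0 < r := FTE_radius_gt0 n_gt0.
have -> : Num.sqrt (enorm x ^+ 2 / d) = enorm x / (Num.sqrt beta * r).
  have Er : Num.sqrt (r ^+ 2) = r by rewrite sqrtr_sqr ger0_norm// ltW.
  have Ee : Num.sqrt (enorm x ^+ 2) = enorm x by rewrite sqrtr_sqr ger0_norm// ltW.
  rewrite /vdegree -FTE_radiusE sqrtrM ?sqr_ge0// Ee.
  rewrite sqrtrV ?(mulr_ge0 (ltW beta_gt0) (sqr_ge0 _))//.
  by rewrite sqrtrM ?(ltW beta_gt0)// Er.
rewrite /HE_edge /FTE_edge /edge_coord /radial tnth_mktuple.
have sb : 0 < Num.sqrt beta by rewrite sqrtr_gt0.
have s2 : 0 < Num.sqrt (2 * N%:R : R) by rewrite sqrtr_gt0 mulr_gt0.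
have -> : Num.sqrt (2 * beta * N%:R) = Num.sqrt beta * Num.sqrt (2 * N%:R).
  by rewrite -sqrtrM ?(ltW beta_gt0)// mulrCA mulrA.
by field; rewrite !gt_eqF.
Qed.

(** If the squared norm is within a relative [delta] of [d], the two edge
    variables are close and the first term suffices, the cutoff [h] being at
    least 1 wherever [f u] and [f v] can differ; otherwise one of the two tilts is at least 1 and
    the second term exceeds the trivial bound [2 * B]. *)
Lemma edge_pointwise (f h : R -> R) (B M eta eps delta : R) (x : Rn R N) :
  0 <= M -> eta <= 1 -> 0 <= eps ->
  0 < delta -> delta <= 2^-1 -> 2 * delta * (M + 2 * q) <= eta ->
  (forall u, M < `|u| -> f u = 0) -> (forall u, `|f u| <= B) ->
  (forall u v, `|u - v| <= eta -> `|f u - f v| <= eps) ->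
  (forall u, 0 <= h u) -> (forall u, `|u| <= M + 1 -> 1 <= h u) ->
  `|f (HE_edge x) - f (FTE_edge x)| <=
    eps * h (HE_edge x) + 2 * B * (tilt beta delta x + tilt beta (- delta) x).
Proof.
move=> M0 eta1 eps0 d0 d2 deta fM fB funi h0 h1.
set u := HE_edge x; set v := FTE_edge x.
have B0 : 0 <= B := le_trans (normr_ge0 _) (fB 0).
have D0 : 0 < d := vdegree_gt0 beta_gt0 n_gt0.
have t0 e : 0 <= tilt beta e x by exact: expR_ge0.
have [good|bad] := leP `|enorm x ^+ 2 / d - 1| delta.
- have x0 : 0 < enorm x.
    rewrite lt0r enorm_ge0 andbT; apply: contraTN good => /eqP ->.
    by rewrite expr0n mul0r sub0r normrN normr1 -ltNge; lra.
  rewrite (@le_trans _ _ (eps * h u))//; last first.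
    by rewrite lerDl !mulr_ge0// addr_ge0.
  have [/orP uvM|/norP[]] := boolP ((`|u| <= M) || (`|v| <= M)); last first.
    rewrite -!ltNge => /fM -> /fM ->.
    by rewrite subrr normr0 mulr_ge0.
  have U0 : 0 <= enorm x ^+ 2 / d by rewrite divr_ge0 ?sqr_ge0// ltW.
  have Ud : `|Num.sqrt (enorm x ^+ 2 / d) - 1| <= delta.
    by apply: norm_sub1_le_sqr; rewrite ?sqrtr_ge0// sqr_sqrtr.
  have q0 : 0 < q by rewrite powR_gt0.
  have uv := rescaling_close q0 (edge_relation x0) Ud d2 uvM.
  have {}uv := le_trans uv deta.
  rewrite (le_trans (funi _ _ uv))// ler_peMr// h1//.
  case: uvM => [uM|vM]; first by rewrite (le_trans uM)// lerDl.
  rewrite -[u](subrK v) addrC (le_trans (ler_normD _ _))// lerD//.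
  exact: le_trans uv eta1.
- rewrite (@le_trans _ _ (2 * B))//.
    by rewrite (le_trans (ler_normB _ _))// mulr_natl mulr2n lerD.
  have one : 1 <= tilt beta delta x + tilt beta (- delta) x.
    have [b|b] := leP 0 (enorm x ^+ 2 / d - 1).
      apply: (@le_trans _ _ (tilt beta delta x)); last by rewrite lerDl.
      rewrite -expR0 ler_expR; move: bad; rewrite ger0_norm// ltrBrDl ltr_pdivlMr// => bad.
      by rewrite !mulr_ge0//; lra.
    apply: (@le_trans _ _ (tilt beta (- delta) x)); last by rewrite lerDr.
    rewrite -expR0 ler_expR; move: bad; rewrite ltr0_norm// opprB ltrBrDl -ltrBrDr ltr_pdivrMr// => bad.
    have X : 0 <= (1 - delta) * d - enorm x ^+ 2 by rewrite subr_ge0 ltW.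
    by have := mulr_ge0 (ltW d0) X; lra.
  rewrite (le_trans (_ : _ <= 2 * B * (tilt beta delta x + tilt beta (- delta) x)))//.
    by rewrite ler_peMr// mulr_ge0.
  by rewrite lerDr mulr_ge0.
Qed.

End comparison.

(** * Test functions *)

Section Cc_facts.
Context {R : realType}.

Lemma Cc_support_bounded (f : R -> R) : Cc f ->
  exists2 M, 0 <= M & forall u, M < `|u| -> f u = 0.
Proof.
move=> [_ /compact_bounded [M0 [_ M0P]]].
exists (`|M0| + 1); first by rewrite addr_ge0.
move=> u Mu; apply/eqP; apply: contraTT (Mu) => fu; rewrite -leNgt.
apply: (M0P (`|M0| + 1)); last exact: subset_closure.
by rewrite (le_lt_trans (ler_norm _))// ltrDl.
Qed.

Lemma Cc_bounded (f : R -> R) : Cc f -> exists B, forall u, `|f u| <= B.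
Proof.
move=> fC; have [M M0 fM] := Cc_support_bounded fC.
have [cf _] := fC.
have : compact (f @` `[- M, M]).
  apply: continuous_compact; last exact: segment_compact.
  exact: continuous_subspaceT.
move=> /compact_bounded [B [_ BP]].
exists (`|B| + 1) => u; have [uM|uM] := leP `|u| M.
  apply: (BP (`|B| + 1)); first by rewrite (le_lt_trans (ler_norm _))// ltrDl.
  by exists u => //; rewrite /= in_itv /= -ler_norml.
by rewrite fM// normr0 addr_ge0.
Qed.

Lemma Cc_measurable (f : R -> R) : Cc f -> measurable_fun setT f.
Proof. by move=> [cf _]; exact: continuous_measurable_fun. Qed.

Lemma Cc_uniformly_continuous (f : R -> R) (eps : R) : Cc f -> 0 < eps ->
  exists2 eta, 0 < eta & forall u v, `|u - v| <= eta -> `|f u - f v| <= eps.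
Proof.
move=> fC eps0; have [M M0 fM] := Cc_support_bounded fC.
have [cf _] := fC.
have /compact_near_coveringP/(_ R 0^'+ (fun eta u => forall v, `|u - v| <= eta -> `|f u - f v| <= eps)) H :
  compact `[- (M + 1), M + 1] by exact: segment_compact.
have {H} : \forall eta \near 0^'+, `[- (M + 1), M + 1]%classic `<=`
    (fun u => forall v, `|u - v| <= eta -> `|f u - f v| <= eps).
  apply: H => x _.
  have e2 : 0 < eps / 2 by rewrite divr_gt0.
  have /cvgrPdist_le/(_ _ e2) /nbhs_ballP[del /= del0 delP] := cf x.
  near=> u eta => v uv /=.
  have ux : ball x (del / 2) u by near: u; apply: nbhsx_ballx; rewrite divr_gt0.
  have eta2 : eta < del / 2 by near: eta; apply: nbhs_right_lt; rewrite divr_gt0.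
  have xu : `|f x - f u| <= eps / 2.
    by apply: delP; apply: le_ball ux; rewrite ler_pdivrMr// ler_peMr ?ltW// ltr1n.
  have xv : `|f x - f v| <= eps / 2.
    apply: delP; rewrite /ball/= -(subrK u x) -addrA.
    rewrite (le_lt_trans (ler_normD _ _))// [del](splitr del) ltr_leD//.
    exact: le_trans uv (ltW eta2).
  rewrite -(subrK (f x) (f u)) -addrA (le_trans (ler_normD _ _))//.
  by rewrite (splitr eps) lerD// distrC.
move=> near_eta.
have [eta [eta0 eta1 etaP]] : exists eta, [/\ 0 < eta, eta < 1 &
    `[- (M + 1), M + 1]%classic `<=`
    (fun u => forall v, `|u - v| <= eta -> `|f u - f v| <= eps)].
  near (0 : R)^'+ => eta; exists eta; split.
  - by near: eta; exact: nbhs_right_gt.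
  - by near: eta; apply: nbhs_right_lt.
  - by near: eta.
exists eta => // u v uv; have [uM|uM] := leP `|u| (M + 1).
  by apply: etaP => //=; rewrite in_itv/= -ler_norml.
rewrite !fM ?subrr ?normr0 ?(ltW eps0)//; last first.
  by rewrite (lt_trans _ uM)// ltrDl.
have : `|u| <= `|u - v| + `|v| by rewrite -{1}(subrK v u) ler_normD.
lra.
Unshelve. all: by end_near. Qed.

Definition trapezoid (M u : R) : R := Num.max 0 (Num.min 1 (M + 2 - `|u|)).

Lemma trapezoid_Cc M : Cc (trapezoid M).
Proof.
split.
  move=> x; apply: (@continuous_max _ _ (cst 0) ((cst 1) \min (fun u => M + 2 - `|u|)) x).
    exact: cvg_cst.
  apply: continuous_min; first exact: cvg_cst.
  by apply: cvgB; [exact: cvg_cst|exact: norm_continuous].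
have sub : closure [set x | trapezoid M x != 0] `<=` `[- (M + 2), M + 2].
  rewrite -[X in _ `<=` X](_ : closure `[- (M + 2), M + 2] = _); last first.
    by apply/esym/closure_id; exact: interval_closed.
  apply: closureS => x /=; rewrite in_itv/= -ler_norml.
  apply: contraNT; rewrite -ltNge => xM; rewrite /trapezoid max_l// ge_min.
  by rewrite subr_le0 (ltW xM) orbT.
apply: (subclosed_compact _ _ sub); first exact: closed_closure.
exact: segment_compact.
Qed.

Lemma trapezoid_ge0 M u : 0 <= trapezoid M u.
Proof. by rewrite /trapezoid le_max lexx. Qed.

Lemma trapezoid_le1 M u : trapezoid M u <= 1.
Proof. by rewrite /trapezoid ge_max ler01 ge_min lexx. Qed.

Lemma trapezoid_ge1 M u : `|u| <= M + 1 -> 1 <= trapezoid M u.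
Proof.
move=> uM; rewrite /trapezoid le_max le_min lexx /=; apply/orP; right.
by lra.
Qed.

End Cc_facts.

(** * Comparison of the two rescaled integrals *)

Section integrated.
Context {R : realType} (beta : R) (beta_gt0 : 0 < beta) (n : nat) (n_gt0 : (0 < n)%N).
Local Notation N := n.+1.
Local Notation W := (@HE_weight R beta N).
Local Notation Z := (@HE_partition R beta N).
Local Notation vol := (@lebesgue_tuple R N).
Local Notation d := (vdegree beta N).
Local Notation q := (N%:R `^ (2 / 3) : R).
Local Notation w := (@HE_normalized R beta n).

Lemma integrable_HE_normalized : vol.-integrable setT (EFin \o w).
Proof.
have iHE : vol.-integrable setT (fun x => (Z^-1 * W x)%:E).
  apply/integrableP; split.
    by apply/measurable_EFinP; exact: measurable_HE_density.
  under eq_integral do rewrite gee0_abs ?lee_fin ?HE_density_ge0//.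
  exact: integral_HE_density_lty.
rewrite (_ : EFin \o w = fun x => (N%:R%:E * (Z^-1 * W x)%:E)%E) //.
exact: integrableZl.
Qed.

Lemma integrable_bounded_HE (g : Rn R N -> R) C :
  measurable_fun setT g -> (forall x, `|g x| <= C) ->
  vol.-integrable setT (fun x => (g x * w x)%:E).
Proof.
move=> mg gC.
have mw : measurable_fun setT w.
  by apply: measurable_funM => //; exact: measurable_HE_density.
apply: (@le_integrable _ _ _ _ _ measurableT _ (fun x => (C * w x)%:E)).
- by apply/measurable_EFinP; exact: measurable_funM.
- move=> x _; rewrite !abse_EFin lee_fin !normrM ler_wpM2r//.
  by rewrite (le_trans (gC x))// ler_norm.
- under eq_fun do rewrite EFinM.
  apply: integrableZl => //; exact: integrable_HE_normalized.
Qed.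

Lemma tilt_HE_normalized delta x :
  tilt beta delta x * w x = N%:R * Z^-1 * (tilt beta delta x * W x).
Proof. by rewrite /HE_normalized; ring. Qed.

Lemma integrable_tilt_HE delta : `|delta| <= 2^-1 ->
  vol.-integrable setT (fun x => (tilt beta delta x * w x)%:E).
Proof.
move=> d2; under eq_fun do rewrite tilt_HE_normalized EFinM.
by apply: integrableZl => //; exact: integrable_tilt.
Qed.

Lemma Rintegral_tilt_HE delta : `|delta| <= 2^-1 ->
  \int[vol]_x (tilt beta delta x * w x) <=
  N%:R * expR (- (d * delta ^+ 2 / 16) + N%:R * `|delta|).
Proof.
move=> d2; under eq_Rintegral do rewrite tilt_HE_normalized.
rewrite RintegralZl//; last exact: integrable_tilt.
have Z0 : 0 <= Z by exact: HE_partition_ge0.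
apply: (@le_trans _ _ (N%:R * Z^-1 *
    (expR (- (d * delta ^+ 2 / 16) + N%:R * `|delta|) * Z))).
  apply: ler_wpM2l; last exact: HE_chernoff.
  by rewrite mulr_ge0// invr_ge0.
rewrite -mulrA ler_wpM2l// mulrCA ler_piMr ?expR_ge0//.
have [->|Zn0] := eqVneq Z 0; first by rewrite mulr0.
by rewrite mulVf.
Qed.

Lemma edge_integral_close (f h : R -> R) (B M eta eps delta : R) :
  measurable_fun setT f -> measurable_fun setT h ->
  0 <= M -> eta <= 1 -> 0 <= eps ->
  0 < delta -> delta <= 2^-1 -> 2 * delta * (M + 2 * q) <= eta ->
  (forall u, M < `|u| -> f u = 0) -> (forall u, `|f u| <= B) ->
  (forall u v, `|u - v| <= eta -> `|f u - f v| <= eps) ->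
  (forall u, 0 <= h u <= 1) -> (forall u, `|u| <= M + 1 -> 1 <= h u) ->
  `|\int[vol]_x (f (HE_edge beta x) * w x) - \int[vol]_x (f (FTE_edge x) * w x)| <=
    eps * \int[vol]_x (h (HE_edge beta x) * w x) +
    4 * B * (N%:R * expR (- (d * delta ^+ 2 / 16) + N%:R * delta)).
Proof.
move=> mf mh M0 eta1 eps0 d0 d2 deta fM fB funi h01 h1.
have h0 u : 0 <= h u by case/andP: (h01 u).
have B0 : 0 <= B := le_trans (normr_ge0 _) (fB 0).
have dn : `|delta| <= 2^-1 by rewrite ger0_norm// ltW.
have dN : `|- delta| <= 2^-1 by rewrite normrN.
have iH (k : R -> R) C : measurable_fun setT k -> (forall u, `|k u| <= C) ->
    vol.-integrable setT (fun x => (k (HE_edge beta x) * w x)%:E).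
  move=> mk kC; apply: (integrable_bounded_HE (C := C)) => //.
  by apply: measurableT_comp => //; exact: measurable_HE_edge.
have iF : vol.-integrable setT (fun x => (f (FTE_edge x) * w x)%:E).
  apply: (integrable_bounded_HE (C := B)) => //.
  by apply: measurableT_comp => //; exact: measurable_FTE_edge.
have iHf := iH _ _ mf fB.
have iHh : vol.-integrable setT (fun x => (h (HE_edge beta x) * w x)%:E).
  by apply: (iH _ 1) => // u; rewrite ger0_norm//; case/andP: (h01 u).
have it1 := integrable_tilt_HE dn.
have it2 := integrable_tilt_HE dN.
have iD := integrableB measurableT iHf iF.
rewrite -RintegralB//.
apply: (le_trans (le_normr_Rintegral measurableT _)); first exact: iD.
pose bd x := eps * (h (HE_edge beta x) * w x) +
  2 * B * (tilt beta delta x * w x + tilt beta (- delta) x * w x).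
have ieh : vol.-integrable setT (fun x => (eps * (h (HE_edge beta x) * w x))%:E).
  by under eq_fun do rewrite EFinM; exact: integrableZl.
have itt : vol.-integrable setT
    (fun x => (tilt beta delta x * w x + tilt beta (- delta) x * w x)%:E).
  by under eq_fun do rewrite EFinD; exact: integrableD.
have itB : vol.-integrable setT
    (fun x => (2 * B * (tilt beta delta x * w x + tilt beta (- delta) x * w x))%:E).
  by under eq_fun do rewrite EFinM; exact: integrableZl.
apply: (@le_trans _ _ (\int[vol]_x bd x)).
  apply: le_Rintegral => //.
  - by apply: integrable_norm; exact: iD.
  - exact: (integrableD measurableT ieh itB).
  - move=> x _; rewrite -mulrBl normrM [X in _ * X]ger0_norm ?HE_normalized_ge0//.
    rewrite (_ : bd x = (eps * h (HE_edge beta x) +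
      2 * B * (tilt beta delta x + tilt beta (- delta) x)) * w x); last first.
      by rewrite /bd; ring.
    rewrite ler_wpM2r ?HE_normalized_ge0//.
    by apply: (@edge_pointwise _ _ beta_gt0 n n_gt0 f h B M eta eps delta x).
rewrite /bd RintegralD// RintegralZl// RintegralZl// RintegralD//.
rewrite lerD2l.
have := Rintegral_tilt_HE dn; have := Rintegral_tilt_HE dN.
rewrite normrN sqrrN (ger0_norm (ltW d0)).
set E := N%:R * expR _; set I1 := Rintegral _ _ _; set I2 := Rintegral _ _ _ => H2 H1.
have : 2 * B * (I2 + I1) <= 2 * B * (E + E).
  by rewrite ler_wpM2l ?mulr_ge0// lerD.
lra.
Qed.

End integrated.

(** * Passage to the limit *)

Section asymptotics.
Context {R : realType}.

(** In terms of [y = root6 N] all exponents become integral: [N = y ^+ 6], the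
    edge scale is [y ^+ 4] and [delta = y ^- 5]. *)
Definition root6 (N : nat) : R := N%:R `^ 6^-1.

Lemma root6X N k : root6 N ^+ k = N%:R `^ (k%:R / 6).
Proof. by rewrite /root6 -powR_mulrn ?powR_ge0// -powRrM mulrC. Qed.

Lemma root6_6 N : root6 N ^+ 6 = N%:R.
Proof. by rewrite root6X divff// powRr1. Qed.

Lemma root6_4 N : root6 N ^+ 4 = N%:R `^ (2 / 3).
Proof. by rewrite root6X; congr (_ `^ _); field. Qed.

Lemma root6_infty (K : R) : \forall N \near \oo, K <= root6 N.
Proof.
near=> N; rewrite (le_trans (ler_norm _))//.
rewrite -(ler_pXn2r (ltn0Sn 5)) ?nnegrE ?powR_ge0// root6_6.
near: N; exact: nbhs_infty_ger.
Unshelve. all: by end_near. Qed.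

Lemma root6_ge1 N : (0 < N)%N -> 1 <= root6 N.
Proof.
move=> N0; rewrite -(ler_pXn2r (ltn0Sn 5)) ?nnegrE ?powR_ge0// root6_6 expr1n.
by rewrite ler1n.
Qed.

Lemma vdegree_ge (beta : R) N : 0 < beta -> (1 < N)%N ->
  beta / 4 * N%:R ^+ 2 <= vdegree beta N.
Proof.
move=> b0 N1; rewrite /vdegree natr_bin2 -mulrA ler_wpM2l ?(ltW b0)//.
have : (2 : R) <= N%:R by rewrite ler_nat.
nra.
Qed.

(** [d * delta ^+ 2 / 16] is at least [c * y ^+ 2] with [c = beta / 64], while
    [N * delta = y] takes at most half of it once [y >= 2 / c].  What remains is
    [y ^+ 6 * expR (- z)] with [z = c * y ^+ 2 / 2], and [expR z >= z ^+ 4 / 4`!]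
    suffices; 384 is [4`! * 2 ^ 4]. *)
Lemma tail_bound (beta : R) N : 0 < beta -> (1 < N)%N ->
  2 / (beta / 64) <= root6 N ->
  N%:R * expR (- (vdegree beta N * (root6 N ^- 5) ^+ 2 / 16) + N%:R * root6 N ^- 5)
  <= 384 / (beta / 64) ^+ 4 / root6 N ^+ 2.
Proof.
move=> b0 N1; set c := beta / 64; set y := root6 N => cy.
have c0 : 0 < c by rewrite divr_gt0.
have y1 : 1 <= y by rewrite root6_ge1// (ltn_trans _ N1).
have y0 : 0 < y by lra.
have NE : N%:R = y ^+ 6 by rewrite root6_6.
have dB : c * y ^+ 2 <= vdegree beta N * (y ^- 5) ^+ 2 / 16.
  have -> : c * y ^+ 2 = beta / 4 * N%:R ^+ 2 * (y ^- 5) ^+ 2 / 16.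
    by rewrite NE /c; field; rewrite gt_eqF.
  by rewrite ler_wpM2r// ler_wpM2r ?sqr_ge0// vdegree_ge.
have yE : N%:R * y ^- 5 = y by rewrite NE; field; rewrite gt_eqF.
rewrite yE NE.
have cy2 : y <= c / 2 * y ^+ 2.
  have : 2 <= c * y by rewrite mulrC -ler_pdivrMr.
  nra.
set z := c / 2 * y ^+ 2 in cy2.
have z0 : 0 < z by rewrite mulr_gt0 ?divr_gt0// exprn_gt0.
have expz : expR (- z) <= 24 / z ^+ 4.
  have := @expR_ge1Dxn R z 3 (ltW z0) => ez.
  rewrite expRN -[leRHS]invf_div lef_pV2 ?posrE ?expR_gt0 ?divr_gt0 ?exprn_gt0//.
  by apply: le_trans ez; rewrite lerDr.
have -> : 384 / c ^+ 4 / y ^+ 2 = y ^+ 6 * (24 / z ^+ 4).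
  by rewrite /z; field; rewrite !gt_eqF.
rewrite ler_pM2l ?exprn_gt0//; apply: le_trans expz.
rewrite ler_expR /z; move: dB cy2; rewrite /z; lra.
Qed.

End asymptotics.

Theorem theorem2 (R : realType) (beta : R) (rhoFTE : nat -> R -> R) (f : R -> R)
    (beta_gt0 : 0 < beta)
    (rhoFTE_density : forall N : nat, (2 <= N)%N ->
      is_FTE_eigenvalue_density beta N (rhoFTE N))
    (f_Cc : Cc f)
    (HE_limit_exists : forall h : R -> R, Cc h ->
      cvgn (fun N : nat =>
        \int[@lebesgue_measure R]_t
          (h t * (Num.sqrt beta * N%:R `^ (5 / 6) / Num.sqrt 2 *
            HE_eigenvalue_density beta N
              (Num.sqrt (2 * beta * N%:R) * (1 + t / (2 * N%:R `^ (2 / 3)))))))) :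
  (fun N : nat =>
    \int[@lebesgue_measure R]_x
      (f x * (N%:R `^ (5 / 6) / Num.sqrt 2 *
        rhoFTE N (Num.sqrt (2 * N%:R) * (1 + x / (2 * N%:R `^ (2 / 3)))))))
    @ \oo -->
  limn (fun N : nat =>
    \int[@lebesgue_measure R]_t
      (f t * (Num.sqrt beta * N%:R `^ (5 / 6) / Num.sqrt 2 *
        HE_eigenvalue_density beta N
          (Num.sqrt (2 * beta * N%:R) * (1 + t / (2 * N%:R `^ (2 / 3))))))).
Proof.
have [M M0 fM] := Cc_support_bounded f_Cc.
have [B fB] := Cc_bounded f_Cc.
have B0 : 0 <= B := le_trans (normr_ge0 _) (fB 0).
pose h : R -> R := trapezoid M.
have h_Cc : Cc h := trapezoid_Cc M.
have h01 u : 0 <= h u <= 1 by rewrite trapezoid_ge0 trapezoid_le1.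
set HEf := (X in limn X).
pose HEh N := \int[@lebesgue_measure R]_t
  (h t * (Num.sqrt beta * N%:R `^ (5 / 6) / Num.sqrt 2 *
    HE_eigenvalue_density beta N
      (Num.sqrt (2 * beta * N%:R) * (1 + t / (2 * N%:R `^ (2 / 3)))))).
have cvgf : HEf @ \oo --> limn HEf by exact: HE_limit_exists.
have cvgh : HEh @ \oo --> limn HEh by exact: HE_limit_exists.
(* the expected number of eigenvalues near the support of f stays bounded *)
pose Ch := `|limn HEh| + 1.
have Ch0 : 0 < Ch by rewrite ltr_wpDl.
have HEh_le : \forall N \near \oo, HEh N <= Ch.
  move/cvgrPdist_le : cvgh => /(_ _ ltr01); apply: filterS => N hN.
  rewrite -[HEh N](subrK (limn HEh)) addrC lerD ?ler_norm//.
  by rewrite (le_trans (ler_norm _))// distrC.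
pose FTEf N := \int[@lebesgue_measure R]_x
  (f x * (N%:R `^ (5 / 6) / Num.sqrt 2 *
    rhoFTE N (Num.sqrt (2 * N%:R) * (1 + x / (2 * N%:R `^ (2 / 3)))))).
rewrite -/FTEf; apply/cvgrPdist_le => e e0.
(* e/2 is spent on the convergence of HEf, e/4 on each of the two terms of
   edge_integral_close *)
pose eps := e / 4 / Ch.
have eps0 : 0 < eps by rewrite !divr_gt0.
have [eta0 eta00 funi] := Cc_uniformly_continuous f_Cc eps0.
pose eta := Num.min eta0 1.
have eta_gt0 : 0 < eta by rewrite lt_min eta00 ltr01.
have eta1 : eta <= 1 by rewrite ge_min lexx orbT.
have etaf u v : `|u - v| <= eta -> `|f u - f v| <= eps.
  by move=> uv; apply: funi; rewrite (le_trans uv)// ge_min lexx.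
pose c := beta / 64.
pose D := 4 * B * (384 / c ^+ 4).
have c0 : 0 < c by rewrite divr_gt0.
have close N : (1 < N)%N -> 2 <= root6 N :> R -> 2 / c <= root6 N ->
    2 * (M + 2) / eta <= root6 N -> D / (e / 4) <= root6 N -> HEh N <= Ch ->
    `|HEf N - FTEf N| <= e / 2.
  case: N => [//|n] N2 y2 yc yeta yD hN.
  have n0 : (0 < n)%N by [].
  have y1 : 1 <= root6 n.+1 :> R by rewrite root6_ge1.
  have y0 : 0 < root6 n.+1 :> R by rewrite (lt_le_trans ltr01).
  pose delta : R := root6 n.+1 ^- 5.
  have delta0 : 0 < delta by rewrite invr_gt0 exprn_gt0.
  have delta2 : delta <= 2^-1.
    by rewrite lef_pV2 ?posrE ?exprn_gt0// (le_trans y2)// ler_eXnr.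
  have deta : 2 * delta * (M + 2 * n.+1%:R `^ (2 / 3)) <= eta.
    rewrite -root6_4 (@le_trans _ _ (2 * (M + 2) / root6 n.+1))//.
      have -> : 2 * (M + 2) / root6 n.+1 =
          2 * delta * (M * root6 n.+1 ^+ 4 + 2 * root6 n.+1 ^+ 4).
        by rewrite /delta; field; rewrite gt_eqF.
      rewrite ler_wpM2l ?mulr_ge0 ?(ltW delta0)// lerD2r ler_peMr//.
      by rewrite exprn_ege1.
    by rewrite ler_pdivrMr// [eta * _]mulrC -ler_pdivrMr//.
  have mf := Cc_measurable f_Cc; have mh := Cc_measurable h_Cc.
  have hbnd u : `|h u| <= 1.
    by have /andP[h0 h1] := h01 u; rewrite ger0_norm.
  move: hN; rewrite /HEf /FTEf /HEh.
  rewrite (Rintegral_HE_edge beta_gt0 n mf fB) (Rintegral_HE_edge beta_gt0 n mh hbnd).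
  rewrite (Rintegral_FTE_edge beta_gt0 n0 (rhoFTE_density _ N2) mf fB) => hN.
  apply: (le_trans (edge_integral_close beta_gt0 n0 mf mh M0 eta1 (ltW eps0)
    delta0 delta2 deta fM fB etaf h01 (fun u => @trapezoid_ge1 _ M u))).
  rewrite (_ : e / 2 = eps * Ch + e / 4); last first.
    by rewrite /eps divfK ?gt_eqF//; field.
  rewrite lerD ?ler_pM2l//.
  have := tail_bound beta_gt0 N2 yc; rewrite -/delta -/c => tailN.
  apply: (@le_trans _ _ (D / root6 n.+1 ^+ 2)).
    by rewrite /D -[leRHS]mulrA ler_wpM2l ?mulr_ge0.
  rewrite ler_pdivrMr ?exprn_gt0// (@le_trans _ _ (e / 4 * root6 n.+1))//.
    by rewrite mulrC -ler_pdivrMr// divr_gt0.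
  by rewrite ler_pM2l ?divr_gt0// ler_eXnr.
near=> N.
have fN : `|limn HEf - HEf N| <= e / 2.
  by near: N; move/cvgrPdist_le : cvgf; apply; rewrite divr_gt0.
rewrite -(subrK (HEf N) (limn HEf)) -addrA (le_trans (ler_normD _ _))//.
rewrite [leRHS](splitr e) lerD// close//; near: N.
- exact: nbhs_infty_gt.
- exact: root6_infty.
- exact: root6_infty.
- exact: root6_infty.
- exact: root6_infty.
- exact: HEh_le.
Unshelve. all: by end_near. Qed.
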